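(* Let $E$ be a complex Banach space and let $(\mathcal{P}_{\Delta}(^{n}E))_{n=0}^{\infty}$ be a sequence of quasi-normed spaces satisfying the standing assumptions of the context. If $(\mathcal{P}_{\Delta}(^{n}E))_{n=0}^{\infty}$ is stable for derivatives with constants $C_{n,k}\le\frac{n!}{(n-k)!}$ (for all $n\in\mathbb{N}_{0}$ and $k=0,1,\dots,n$), then $(\mathcal{P}_{\widetilde{\Delta}}(^{n}E))_{n=0}^{\infty}$ is a holomorphy type (from $E$ to $\mathbb{C}$).
   Context: $\mathbb{N}_{0}=\mathbb{N}\cup\{0\}$; $E'$ is the topological dual of $E$. $\mathcal{P}(^{n}E)$ is the Banach space of continuous $n$-homogeneous polynomials $E\to\mathbb{C}$ with $\|P\|=\sup_{\|x\|\le1}|P(x)|$ and $\mathcal{P}(^{0}E)=\mathbb{C}$. For $\varphi\in E'$, $\varphi^{n}(x)=\varphi(x)^{n}$; $\mathcal{P}_{f}(^{n}E)$ is the linear span of $\{\varphi^{n}:\varphi\in E'\}$. If $P\in\mathcal{P}(^{n}E)$ has associated continuous symmetric $n$-linear form $A$, then for $0\le k\le n$ and $a\in E$, $\hat{d}^{k}P(a)\in\mathcal{P}(^{k}E)$ is the polynomial $\hat{d}^{k}P(a)(y)=\frac{n!}{(n-k)!}A(\underbrace{a,\dots,a}_{n-k},\underbrace{y,\dots,y}_{k})$. Standing assumptions. $\mathcal{P}_{\Delta}(^{0}E)=\mathbb{C}$ (with the modulus). For every $n\in\mathbb{N}$: $(\mathcal{P}_{\Delta}(^{n}E),\|\cdot\|_{\Delta})$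 is a quasi-normed space of $n$-homogeneous polynomials on $E$ with $\mathcal{P}_{f}(^{n}E)\subset\mathcal{P}_{\Delta}(^{n}E)\subset\mathcal{P}(^{n}E)$, the last inclusion being continuous, $\|P\|\le C_{\Delta_{n}}\|P\|_{\Delta}$ with $C_{\Delta_n}>0$; and $(\mathcal{P}_{\Delta'}(^{n}E'),\|\cdot\|_{\Delta'})$ is a normed space, $\mathcal{P}_{\Delta'}(^{n}E')\subset\mathcal{P}(^{n}E')$, such that the Borel transform $\mathcal{B}\colon(\mathcal{P}_{\Delta}(^{n}E)',\|\cdot\|)\to(\mathcal{P}_{\Delta'}(^{n}E'),\|\cdot\|_{\Delta'})$, $\mathcal{B}(T)(\varphi)=T(\varphi^{n})$, is a topological isomorphism, where $\|T\|=\sup\{|T(P)|:\|P\|_{\Delta}\le1\}$. The space $\mathcal{P}_{\widetilde{\Delta}}(^{n}E)$. For $n\in\mathbb{N}$ put $\langle P,Q\rangle=\mathcal{B}^{-1}(Q)(P)$, $U=\{P\in\mathcal{P}_{\Delta}(^{n}E):\|P\|_{\Delta}\le1\}$, $U^{\circ}=\{Q\in\mathcal{P}_{\Delta'}(^{n}E'):|\langle P,Q\rangle|\le1\ \forall P\in U\}$, $U^{\circ\circ}=\{P\in\mathcal{P}_{\Delta}(^{n}E):|\langle P,Q\rangle|\le1\ \forall Q\in U^{\circ}\}$, $p_{U^{\circ\circ}}(P)=\inf\{\delta>0:P\in\delta U^{\circ\circ}\}$ (a norm). $(\mathcal{P}_{\widetilde{\Delta}}(^{n}E),\|\cdot\|_{\widetilde{\Delta}})$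 is the completion of $(\mathcal{P}_{\Delta}(^{n}E),p_{U^{\circ\circ}})$; since $\|P\|\le C_{\Delta_{n}}p_{U^{\circ\circ}}(P)$ on $\mathcal{P}_{\Delta}(^{n}E)$, the inclusion into $\mathcal{P}(^{n}E)$ extends continuously to the completion, and the paper regards $\mathcal{P}_{\widetilde{\Delta}}(^{n}E)$ as a linear subspace of $\mathcal{P}(^{n}E)$ in this way, with $\|P\|\le C_{\Delta_{n}}\|P\|_{\widetilde{\Delta}}$. $\mathcal{P}_{\widetilde{\Delta}}(^{0}E)=\mathbb{C}$. Stable for derivatives: (1) $\hat{d}^{k}P(x)\in\mathcal{P}_{\Delta}(^{k}E)$ for all $n\in\mathbb{N}_{0}$, $P\in\mathcal{P}_{\Delta}(^{n}E)$, $k=0,\dots,n$, $x\in E$; (2) for each $n\in\mathbb{N}_{0}$ and $k=0,\dots,n$ there is a constant $C_{n,k}\ge0$ with $\|\hat{d}^{k}P(x)\|_{\Delta}\le C_{n,k}\|P\|_{\Delta}\|x\|^{n-k}$ for all $P\in\mathcal{P}_{\Delta}(^{n}E)$ and $x\in E$. Holomorphy type from $E$ to $\mathbb{C}$: a sequence of Banach spaces $(\mathcal{P}_{\Theta}(^{n}E),\|\cdot\|_{\Theta})_{n=0}^{\infty}$ such that (1) each $\mathcal{P}_{\Theta}(^{n}E)$ is a linear subspace of $\mathcal{P}(^{n}E)$; (2) $\mathcal{P}_{\Theta}(^{0}E)=\mathbb{C}$ as a normed space; (3) there is $\sigma\ge1$ such that for all $k\le n$ in $\mathbb{N}_{0}$,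 $a\in E$ and $P\in\mathcal{P}_{\Theta}(^{n}E)$: $\hat{d}^{k}P(a)\in\mathcal{P}_{\Theta}(^{k}E)$ and $\left\|\frac{1}{k!}\hat{d}^{k}P(a)\right\|_{\Theta}\le\sigma^{n}\|P\|_{\Theta}\|a\|^{n-k}$.
   Formalization: The completion embeds in P(^nE) only if the extended inclusion is injective, which can fail (e.g. P_f(^nE) with the projective norm, E' without approximation property); here P_Δ̃(^nE) is the image of the completion in P(^nE) with the quotient norm, which agrees with the paper when it is injective. *)

(* Defs.v *)
From HB Require Import structures.
From mathcomp Require Import all_boot all_order all_algebra all_fingroup.
From mathcomp Require Import complex.
From mathcomp Require Import all_classical all_reals.
From mathcomp Require Import topology normedtype sequences.

Set Implicit Arguments.
Unset Strict Implicit.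
Unset Printing Implicit Defensive.

Import Order.TTheory GRing.Theory Num.Theory.
Import numFieldNormedType.Exports.

Local Open Scope classical_set_scope.
Local Open Scope complex_scope.
Local Open Scope ring_scope.

(* In MathComp-Analysis the norm of a complex normed space takes values in
   R[i]; [nrm x] is the same norm, read as an element of R (see [nrmE]).
   The scalar field as a normed space over itself is R[i]^o. *)
Definition nrm (R : realType) (V : normedZmodType R[i]) (x : V) : R :=
  complex.Re `|x|.

Lemma nrmE (R : realType) (V : normedZmodType R[i]) (x : V) :
  `|x| = (nrm x)%:C.
Proof.
rewrite /nrm; have : `|x| \is Num.real by exact: normr_real.
by case: (`|x|) => a b; rewrite complex_real => /eqP /= ->.
Qed.

Lemma nrm_ge0 (R : realType) (V : normedZmodType R[i]) (x : V) : 0 <= nrm x.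
Proof. by rewrite -(ler0c (nrm x)) -nrmE. Qed.

Lemma nrmD (R : realType) (V : normedZmodType R[i]) (x y : V) :
  nrm (x + y) <= nrm x + nrm y.
Proof. by rewrite -lecR rmorphD /= -!nrmE ler_normD. Qed.

Lemma nrmZ (R : realType) (V : normedModType R[i]) (c : R[i]) (x : V) :
  nrm (c *: x) = nrm (c : R[i]^o) * nrm x.
Proof. by apply: complexI; rewrite rmorphM /= -!nrmE normrZ. Qed.

Definition sup_norm (R : realType) (V : normedModType R[i])
    (P : V -> R[i]^o) : R :=
  sup [set nrm (P x) | x in [set x : V | nrm x <= 1]].

(* The topological dual V' of V, with the operator norm. *)
Section Dual.
Context (R : realType) (V : normedModType R[i]).

Definition dual_pred : {pred V -> R[i]^o} :=
  [pred f : V -> R[i]^o | `[< linear f /\ continuous f >]].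

Record dual := Dual { dual_fun :> V -> R[i]^o; _ : dual_fun \in dual_pred }.

HB.instance Definition _ := [isSub for dual_fun].
HB.instance Definition _ := [Choice of dual by <:].

Lemma dual_submod_closed : submod_closed dual_pred.
Proof.
split=> [|c f g].
  apply/asboolP; split=> [a x y|x]; last exact: cvg_cst.
  by rewrite /= scaler0 addr0.
move=> /asboolP[fl fc] /asboolP[gl gc]; apply/asboolP; split.
  move=> a x y; change (c *: f (a *: x + y) + g (a *: x + y) =
    a *: (c *: f x + g x) + (c *: f y + g y)).
  rewrite fl gl !scalerDr !scalerA (mulrC a c) -!addrA; congr (_ + _).
  by rewrite addrCA.
by move=> x; apply: (@cvgD _ R[i]^o); [apply: cvgZr; exact: fc|exact: gc].
Qed.

HB.instance Definition _ :=
  GRing.isSubmodClosed.Build _ _ dual_pred dual_submod_closed.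
HB.instance Definition _ := [SubChoice_isSubLmodule of dual by <:].

Lemma dual_linear (f : dual) : linear f.
Proof. by case: f => f /= /asboolP[]. Qed.

Lemma dual_continuous (f : dual) : continuous f.
Proof. by case: f => f /= /asboolP[]. Qed.

Lemma dual_bounded (f : dual) : exists M : R, forall x, nrm (f x) <= M * nrm x.
Proof.
pose g : {linear V -> R[i]^o} :=
  HB.pack (f : V -> R[i]^o) (GRing.isLinear.Build _ _ _ _ _ (dual_linear f)).
have /linear_boundedP : bounded_near g (nbhs 0).
  by apply: continuous_linear_bounded; exact: dual_continuous.
case=> M [Mr HM].
have M1r : M + 1 \is Num.real by rewrite realD.
exists (complex.Re (M + 1)) => x.
rewrite -lecR rmorphM /= (RRe_real M1r) -!nrmE.
by apply: HM; rewrite ltrDl ltr01.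
Qed.

Lemma dual0 (f : dual) : f 0 = 0.
Proof.
by have := dual_linear f 1 0 0; rewrite !scale1r addr0 => /eqP;
   rewrite -subr_eq subrr => /eqP.
Qed.

Lemma dual_has_sup (f : dual) :
  has_sup [set nrm (f x) | x in [set x : V | nrm x <= 1]].
Proof.
split.
  by exists (nrm (f 0)), 0 => //=; rewrite /nrm normr0 /= ler01.
have [M HM] := dual_bounded f; exists `|M| => _ [x /= x1 <-].
rewrite (le_trans (HM x))// (le_trans (ler_wpM2r (nrm_ge0 x) (ler_norm M)))//.
by rewrite ler_piMr.
Qed.

Lemma dual_le_norm (f : dual) x : nrm x <= 1 -> nrm (f x) <= sup_norm f.
Proof.
by move=> x1; apply: ub_le_sup; [case: (dual_has_sup f)|exists x].
Qed.

Definition dual_norm (f : dual) : R[i] := (sup_norm f)%:C.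

Lemma dual_norm_triangle f g : dual_norm (f + g) <= dual_norm f + dual_norm g.
Proof.
rewrite /dual_norm -rmorphD /= lecR; apply: ge_sup.
  by case: (dual_has_sup (f + g)).
move=> _ [x /= x1 <-]; rewrite (le_trans (nrmD (f x) (g x)))//.
by rewrite lerD// dual_le_norm.
Qed.

Lemma sup_normZ_le c f : sup_norm (c *: f : dual) <= nrm (c : R[i]^o) * sup_norm f.
Proof.
apply: ge_sup; first by case: (dual_has_sup (c *: f)).
move=> _ [x /= x1 <-]; rewrite (nrmZ c (f x)).
by rewrite ler_wpM2l ?nrm_ge0// dual_le_norm.
Qed.

Lemma dual_normZ c f : dual_norm (c *: f) = `|c| * dual_norm f.
Proof.
rewrite /dual_norm (nrmE (c : R[i]^o)) -rmorphM /=; congr (_%:C).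
apply/eqP; rewrite eq_le sup_normZ_le /=.
have [->|c0] := eqVneq c 0.
  rewrite /nrm normr0 /= mul0r.
  by rewrite (le_trans (nrm_ge0 ((0 *: f : dual) 0)))// dual_le_norm// /nrm normr0 /= ler01.
have := sup_normZ_le c^-1 (c *: f).
rewrite scalerA mulVf// scale1r => /(ler_wpM2l (nrm_ge0 (c : R[i]^o))).
rewrite mulrA => /le_trans; apply.
suff -> : nrm (c : R[i]^o) * nrm (c^-1 : R[i]^o) = 1 by rewrite mul1r.
by apply: complexI; rewrite rmorphM /= -!nrmE -normrM mulfV// normr1.
Qed.

Lemma dual_norm_eq0 f : dual_norm f = 0 -> f = 0.
Proof.
move=> /complexI f0; apply/val_inj/funext => x /=.
have nz (y : V) : nrm y <= 1 -> f y = 0.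
  move=> /(@dual_le_norm f); rewrite f0 => fy; apply/eqP.
  by rewrite -normr_eq0 nrmE (_ : nrm (f y) = 0)//; apply/eqP; rewrite eq_le fy nrm_ge0.
have [->|x0] := eqVneq x 0; first exact: dual0.
have : f ((`|x|^-1 : R[i]) *: x) = 0.
  by apply: nz; rewrite -lecR -nrmE normrZ normfV normr_id mulVf// normr_eq0.
have := dual_linear f (`|x|^-1) x 0; rewrite addr0 dual0 addr0 => -> /eqP.
by rewrite scaler_eq0 invr_eq0 normr_eq0 (negPf x0) => /eqP.
Qed.

HB.instance Definition _ := Lmodule_isNormed.Build R[i] dual
  dual_norm_triangle dual_normZ dual_norm_eq0.

End Dual.

(* Spaces of functions are given by a carrier set D in an ambient vector space
   together with a function N which is only meaningful on D. *)
Section NormedSubspaces.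
Context (R : realType).

Definition linear_subspace (V : lmodType R[i]) (D : set V) : Prop :=
  D 0 /\ forall (c : R[i]) u v, D u -> D v -> D (c *: u + v).

Definition quasi_normed (V : lmodType R[i]) (D : set V) (N : V -> R) : Prop :=
  [/\ linear_subspace D,
      forall u, D u -> 0 <= N u /\ (N u = 0 -> u = 0),
      forall (c : R[i]) u, D u -> N (c *: u) = nrm (c : R[i]^o) * N u &
      exists2 K : R, 1 <= K &
        forall u v, D u -> D v -> N (u + v) <= K * (N u + N v)].

Definition normed (V : lmodType R[i]) (D : set V) (N : V -> R) : Prop :=
  [/\ linear_subspace D,
      forall u, D u -> 0 <= N u /\ (N u = 0 -> u = 0),
      forall (c : R[i]) u, D u -> N (c *: u) = nrm (c : R[i]^o) * N u &
      forall u v, D u -> D v -> N (u + v) <= N u + N v].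

Definition cauchy_seq_in (V : zmodType) (D : set V) (N : V -> R)
    (u : nat -> V) : Prop :=
  (forall j, D (u j)) /\
  forall e : R, 0 < e -> exists m : nat,
    forall i j, (m <= i)%N -> (m <= j)%N -> N (u i - u j) < e.

Definition converges_to (V : zmodType) (N : V -> R) (u : nat -> V) (v : V) :=
  (fun j => N (u j - v)) @ \oo --> (0 : R).

Definition banach (V : lmodType R[i]) (D : set V) (N : V -> R) : Prop :=
  normed D N /\
  forall u, cauchy_seq_in D N u -> exists2 v, D v & converges_to N u v.

Definition continuous_between (V W : zmodType) (D : set V) (N : V -> R)
    (M : W -> R) (f : V -> W) : Prop :=
  forall u, D u -> forall e : R, 0 < e -> exists2 d : R, 0 < d &
    forall v, D v -> N (v - u) < d -> M (f v - f u) < e.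

(* The topological dual of (D, N).  A functional on D is represented by its
   extension by 0 outside D, so that each one has exactly one representative. *)
Definition functionals (V : lmodType R[i]) (D : set V) (N : V -> R)
    : set (V -> R[i]^o) :=
  [set T | [/\ forall (c : R[i]) u v, D u -> D v ->
                 T (c *: u + v) = c *: T u + T v,
               continuous_between D N (fun z : R[i]^o => nrm z) T &
               forall u, ~ D u -> T u = 0]].

Definition functional_norm (V : lmodType R[i]) (D : set V) (N : V -> R)
    (T : V -> R[i]^o) : R :=
  sup [set nrm (T u) | u in [set u | D u /\ N u <= 1]].

End NormedSubspaces.

Section Polynomials.
Context (R : realType) (V : normedModType R[i]).
Local Notation C := (R[i]^o).

Definition symmetric_multilinear (n : nat) (A : ('I_n -> V) -> C) : Prop :=
  (forall (i : 'I_n) (x : 'I_n -> V) (c : R[i]) (u v : V),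
     A (fun j => if j == i then c *: u + v else x j) =
     c *: A (fun j => if j == i then u else x j) +
     A (fun j => if j == i then v else x j)) /\
  (forall (s : 'S_n) (x : 'I_n -> V), A (fun j => x (s j)) = A x).

Definition is_form_of (n : nat) (P : V -> C) (A : ('I_n -> V) -> C) : Prop :=
  symmetric_multilinear A /\ forall x, P x = A (fun=> x).

(* P(^n V); for n = 0 these are the constant functions. *)
Definition hompoly (n : nat) : set (V -> C) :=
  [set P | (exists A : ('I_n -> V) -> C, is_form_of P A) /\ continuous P].

(* By the polarization formula the form A of P is unique, and it is continuous
   when P is. *)
Definition assoc_form (n : nat) (P : V -> C) : ('I_n -> V) -> C :=
  xget (fun=> 0) [set A | is_form_of P A].

Definition dhat (n k : nat) (P : V -> C) (a : V) : V -> C :=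
  fun y => (n`!%:R / (n - k)`!%:R : R[i]) *:
    assoc_form P (fun i : 'I_n => if (i < n - k)%N then a else y).

Definition dual_pow (n : nat) (f : dual V) : V -> C := fun x => f x ^+ n.

Definition finite_type_poly (n : nat) : set (V -> C) :=
  [set P | exists s : seq (R[i] * dual V),
             P = \sum_(cf <- s) cf.1 *: dual_pow n cf.2].

Definition constants : set (V -> C) := [set P | exists c : C, P = cst c].

Definition constants_norm (P : V -> C) : R := nrm (P 0).

Definition stable_for_derivatives (D : nat -> set (V -> C))
    (N : nat -> (V -> C) -> R) (c : nat -> nat -> R) : Prop :=
  (forall n P k x, D n P -> (k <= n)%N -> D k (dhat n k P x)) /\
  (forall n k, (k <= n)%N -> 0 <= c n k /\
     forall P x, D n P ->
       N k (dhat n k P x) <= c n k * N n P * nrm x ^+ (n - k)).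

Record holomorphy_type (D : nat -> set (V -> C))
    (N : nat -> (V -> C) -> R) : Prop := HolomorphyType {
  holtype_banach : forall n, banach (D n) (N n) ;
  holtype_sub : forall n, D n `<=` hompoly n ;
  holtype_0 : D 0%N = constants /\
    (forall P, D 0%N P -> N 0%N P = constants_norm P) ;
  holtype_dhat : exists2 sigma : R, 1 <= sigma &
    forall n k a P, (k <= n)%N -> D n P ->
      D k (dhat n k P a) /\
      N k ((k`!%:R^-1 : R[i]) *: dhat n k P a) <=
        sigma ^+ n * N n P * nrm a ^+ (n - k) }.

End Polynomials.

Section Borel.
Context (R : realType) (E : normedModType R[i]).
Local Notation C := (R[i]^o).

Definition borel (n : nat) (T : (E -> C) -> C) : dual E -> C :=
  fun f => T (dual_pow n f).

Definition borel_inv (n : nat) (D : set (E -> C)) (N : (E -> C) -> R)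
    (Q : dual E -> C) : (E -> C) -> C :=
  xget (fun=> 0) [set T | functionals D N T /\ borel n T = Q].

(* [borel n] is linear by definition. *)
Definition borel_isomorphism (n : nat) (D : set (E -> C)) (N : (E -> C) -> R)
    (D' : set (dual E -> C)) (N' : (dual E -> C) -> R) : Prop :=
  [/\ set_bij (functionals D N) D' (borel n),
      continuous_between (functionals D N) (functional_norm D N) N' (borel n) &
      continuous_between D' N' (functional_norm D N) (borel_inv n D N)].

Record standing_assumptions
    (D : nat -> set (E -> C)) (N : nat -> (E -> C) -> R)
    (D' : nat -> set (dual E -> C)) (N' : nat -> (dual E -> C) -> R) : Prop :=
  StandingAssumptions {
  std_0 : D 0%N = @constants R E /\
    (forall P, D 0%N P -> N 0%N P = constants_norm P) ;
  std_quasi_normed : forall n, (0 < n)%N -> quasi_normed (D n) (N n) ;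
  std_finite_type : forall n, (0 < n)%N -> @finite_type_poly R E n `<=` D n ;
  std_hompoly : forall n, (0 < n)%N -> D n `<=` @hompoly R E n ;
  std_sup_norm : forall n, (0 < n)%N -> exists2 c : R, 0 < c &
    forall P, D n P -> sup_norm P <= c * N n P ;
  std_normed' : forall n, (0 < n)%N -> normed (D' n) (N' n) ;
  std_hompoly' : forall n, (0 < n)%N -> D' n `<=` @hompoly R (dual E) n ;
  std_borel : forall n, (0 < n)%N ->
    borel_isomorphism n (D n) (N n) (D' n) (N' n) }.

(* The bidual seminorm p_{U^oo} and the completion, for one degree n. *)
Section Tilde.
Context (n : nat) (D : set (E -> C)) (N : (E -> C) -> R)
        (D' : set (dual E -> C)).

Definition pairing (P : E -> C) (Q : dual E -> C) : C := borel_inv n D N Q P.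

Definition unit_ball : set (E -> C) := [set P | D P /\ N P <= 1].

Definition polar : set (dual E -> C) :=
  [set Q | D' Q /\ forall P, unit_ball P -> nrm (pairing P Q) <= 1].

Definition bipolar : set (E -> C) :=
  [set P | D P /\ forall Q, polar Q -> nrm (pairing P Q) <= 1].

Definition bipolar_gauge (P : E -> C) : R :=
  inf [set d : R | 0 < d /\ exists2 P0, bipolar P0 & P = d%:C *: P0].

(* Points of the completion of (D, p_{U^oo}) are classes of Cauchy sequences u,
   two of them being identified when p_{U^oo} (u j - v j) tends to 0, and the
   norm of the class of u is lim p_{U^oo} (u j).  The continuous extension of
   the inclusion into P(^n E) maps the class of u to the limit P of u for the
   sup norm. *)
Definition completion_point (u : nat -> E -> C) (P : E -> C) : Prop :=
  [/\ cauchy_seq_in D bipolar_gauge u, @hompoly R E n P &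
      converges_to (@sup_norm R E) u P].

Definition completion_in_hompoly : set (E -> C) :=
  [set P | exists u, completion_point u P].

(* The norm carried over from the completion: the infimum of the norms of the
   points of the completion that are mapped to P.  When the extension is
   injective there is just one such point and this is its norm; without
   injectivity this is the norm of the quotient by the kernel. *)
Definition completion_norm (P : E -> C) : R :=
  inf [set l : R | exists2 u, completion_point u P &
                     (fun j => bipolar_gauge (u j)) @ \oo --> l].

End Tilde.

Definition tilde (D : nat -> set (E -> C)) (N : nat -> (E -> C) -> R)
    (D' : nat -> set (dual E -> C)) (n : nat) : set (E -> C) :=
  if n is 0%N then @constants R E
  else completion_in_hompoly n (D n) (N n) (D' n).

Definition tilde_norm (D : nat -> set (E -> C)) (N : nat -> (E -> C) -> R)
    (D' : nat -> set (dual E -> C)) (n : nat) : (E -> C) -> R :=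
  if n is 0%N then @constants_norm R E
  else completion_norm n (D n) (N n) (D' n).

End Borel.

(* Main.v *)
Require Import Defs.
From mathcomp Require Import all_boot all_order all_algebra all_fingroup.
From mathcomp Require Import complex.
From mathcomp Require Import all_classical all_reals.
From mathcomp Require Import topology normedtype sequences.
From mathcomp Require Import lra.

Import Order.TTheory GRing.Theory Num.Theory.
Import numFieldNormedType.Exports.

Local Open Scope classical_set_scope.
Local Open Scope complex_scope.
Local Open Scope ring_scope.

(** Fix a degree n >= 1 and write p for the gauge of the bipolar of the unit ball
    of (D n, N n).  The Borel transform is a bijection from the continuous
    functionals on (D n, N n) onto D' n, so p P is the supremum of |T P| over the
    functionals T with |T| <= N n.  Consequently p is a seminorm although N n is
    only a quasi-norm, and every linear functional L on D n with |L| <= M * N n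
    satisfies |L| <= M * p ([dominated_le_gauge]).  An estimate for the quasi-norm
    that can be read through functionals is thus also an estimate for p, with the
    same constant.

    This is used for two kinds of functionals.  Evaluations at points of the unit
    ball give that the sup norm is at most K * p, so p is a norm and sequences that
    are Cauchy for p converge to polynomials.  The functionals sending P to
    T (dhat n k P a), with T contractive in degree k, give
    p_k (dhat n k P a) <= c n k * |a|^(n - k) * p_n P ([gauge_dhat_le]); for k = 0
    the evaluation at a plays this role.

    These bounds are then extended to the completions.  By the polarization formula
    ([polarization]) the form of a polynomial is a combination of finitely many of
    its values; therefore P(^n E) is complete for the sup norm
    ([hompoly_complete]) and dhat n k P a depends continuously on P for pointwise
    convergence, so that a sequence representing P is mapped by dhat to one
    representing dhat n k P a ([completion_dhat]).  The norm carried over to the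
    image of the completion is a quotient norm, which is complete because Cauchy
    sequences lift ([completion_banach]).

    Since c n k / k! is at most the binomial coefficient of n and k, hence at most
    2 ^ n, the axiom on derivatives holds with sigma = 2. *)

(** * Multilinear expansion and polarization *)

Section Multilinear.
Context {R : realType} {V : normedModType R[i]}.
Local Notation C := (R[i]^o).

Lemma multilinear_slot_sum {n} {A : ('I_n -> V) -> C} (hA : symmetric_multilinear A)
    (i : 'I_n) (x : 'I_n -> V) (I : finType) (g : I -> V) :
  A (fun j => if j == i then \sum_a g a else x j) =
  \sum_a A (fun j => if j == i then g a else x j).
Proof.
have [hlin _] := hA.
pose L u := A (fun j => if j == i then u else x j).
have LD u v : L (u + v) = L u + L v.
  by have := hlin i x 1 u v; rewrite !scale1r.
have L0 : L 0 = 0.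
  by have := LD 0 0; rewrite addr0 => /eqP; rewrite -subr_eq subrr => /eqP.
exact: (big_morph L LD L0).
Qed.

(** The form is expanded in one slot at a time, for the slots listed in a
    sequence r; the choice functions f are made to take a default value on the
    slots not yet expanded, so that each is counted once.  The number of
    summands equals the number of slots because this is what polarization
    uses. *)
Lemma multilinear_sum {n} {A : ('I_n.+1 -> V) -> C} (hA : symmetric_multilinear A)
    (x : 'I_n.+1 -> 'I_n.+1 -> V) :
  A (fun j => \sum_a x j a) =
  \sum_(f : {ffun 'I_n.+1 -> 'I_n.+1}) A (fun j => x j (f j)).
Proof.
pose T := {ffun 'I_n.+1 -> 'I_n.+1}.
pose F (r : seq 'I_n.+1) (f : T) := [forall j, (j \notin r) ==> (f j == ord0)].
suff H (r : seq 'I_n.+1) y : uniq r ->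
    A (fun j => if j \in r then \sum_a x j a else y j) =
    \sum_(f : T | F r f) A (fun j => if j \in r then x j (f j) else y j).
  have := H (enum 'I_n.+1) (fun=> 0) (enum_uniq _).
  under eq_bigr => f _ do under eq_fun => j do rewrite mem_enum /=.
  under eq_fun => j do rewrite mem_enum /=.
  move=> ->; apply: eq_bigl => f; apply/forallP => j.
  by rewrite mem_enum.
elim: r y => [|i r IHr] y /=.
  move=> _; rewrite (big_pred1 [ffun=> ord0])// => f.
  apply/forallP/eqP => [Df|-> j]; last by rewrite ffunE eqxx.
  by apply/ffunP => j; rewrite ffunE; apply/eqP; have := Df j.
case/andP=> nri ur.
transitivity (A (fun j => if j == i then \sum_a x i a else
   if j \in r then \sum_a x j a else y j)).
  by congr A; apply/funext => j; rewrite in_cons; case: eqVneq => [->|].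
rewrite (multilinear_slot_sum hA).
rewrite (partition_big (fun f : T => f i) predT)//=.
apply: eq_bigr => a _.
(* Choice functions for i :: r with value a at i correspond to those for r by
   resetting the value at i. *)
pose seti b (f : T) : T := [ffun k => if k == i then b else f k].
rewrite (reindex_onto (seti a) (seti ord0)) => [|f /andP[_ /eqP fi]]; last first.
  by apply/ffunP=> k; rewrite !ffunE; case: eqP => // ->.
transitivity (A (fun j => if j \in r then \sum_a x j a else
    if j == i then x i a else y j)).
  congr A; apply/funext => j; case: eqVneq => // ->.
  by rewrite (negPf nri).
rewrite IHr//; apply: eq_big => [f|f _]; last first.
  congr A; apply/funext => j; rewrite in_cons !ffunE; case: eqVneq => // ->.
  by rewrite (negPf nri).
rewrite !ffunE eqxx eqxx andbT; apply/forallP/andP => [Df|[/forallP Df]].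
  split.
    by apply/forallP => k; rewrite in_cons ffunE; case: eqVneq => //=.
  apply/eqP/ffunP => k; rewrite !ffunE; case: eqVneq => // ->.
  by have := Df i; rewrite nri => /eqP.
move=> /eqP/ffunP fE k.
have := fE k; have := Df k; rewrite !ffunE in_cons.
by case: eqVneq => //= _ _ <-; rewrite eqxx implybT.
Qed.

Lemma multilinearZ {n} {A : ('I_n -> V) -> C} (hA : symmetric_multilinear A)
    (t : 'I_n -> R[i]) (x : 'I_n -> V) :
  A (fun j => t j *: x j) = (\prod_j t j) * A x.
Proof.
have [hlin _] := hA.
have slotZ i (y : 'I_n -> V) c u : A (fun j => if j == i then c *: u else y j) =
    c * A (fun j => if j == i then u else y j).
  have h0 : A (fun j => if j == i then 0 else y j) = 0.
    have := hlin i y 1 0 0; rewrite !scale1r addr0 => /eqP.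
    by rewrite -subr_eq subrr => /eqP.
  by have := hlin i y c u 0; rewrite addr0 h0 addr0.
suff H (r : seq 'I_n) : uniq r ->
   A (fun j => if j \in r then t j *: x j else x j) = (\prod_(j <- r) t j) * A x.
  have := H (enum 'I_n) (enum_uniq _); rewrite big_enum => <-.
  by congr A; apply/funext => j; rewrite mem_enum.
elim: r => [_|i r IHr /= /andP[nri ur]]; first by rewrite big_nil mul1r.
rewrite big_cons -mulrA -IHr//.
transitivity (A (fun j => if j == i then t i *: x i else
   if j \in r then t j *: x j else x j)).
  by congr A; apply/funext => j; rewrite in_cons; case: eqVneq => [->|].
rewrite slotZ; congr (_ * A _); apply/funext => j.
by case: eqVneq => // ->; rewrite (negPf nri).
Qed.

(** Expanding P at the sum of the x_i, i in S, gives the values of the form at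
    all x o f with f mapping into S.  The alternating sum over S leaves only the
    surjective f, that is the permutations, and each of these contributes A x by
    symmetry. *)
Theorem polarization {n} {P : V -> C} {A : ('I_n -> V) -> C} (hA : is_form_of P A)
    (x : 'I_n -> V) :
  n`!%:R * A x =
  \sum_(S : {set 'I_n}) (-1) ^+ #|~: S| * P (\sum_(i in S) x i).
Proof.
case: hA => hA hP.
case: n A hA hP x => [|n] A hA hP x.
  have S0 (S : {set 'I_0}) : S = finset.set0 by apply/setP => -[].
  rewrite (big_pred1 finset.set0) => [|S]; last by apply/esym/eqP; exact: S0.
  rewrite hP fact0 (_ : #|_| = 0%N) ?expr0; last first.
    by apply/eqP; rewrite -leqn0 (leq_trans (max_card _))// card_ord.
  by congr (_ * A _); apply/funext => -[].
pose t (S : {set 'I_n.+1}) i : R[i] := (i \in S)%:R.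
have PE (S : {set 'I_n.+1}) : P (\sum_(i in S) x i) =
    \sum_(f : {ffun 'I_n.+1 -> 'I_n.+1}) (\prod_j t S (f j)) * A (fun j => x (f j)).
  rewrite hP; transitivity (A (fun=> \sum_i t S i *: x i)).
    congr A; apply/funext => _; rewrite big_mkcond; apply: eq_bigr => i _.
    by rewrite /t; case: (i \in S); rewrite ?scale1r ?scale0r.
  rewrite (multilinear_sum hA); apply: eq_bigr => f _.
  exact: (multilinearZ hA).
under eq_bigr => S _ do rewrite PE big_distrr /=.
rewrite exchange_big /=.
(* The sum over S factors as the product over i of 1 + c i, where the factor of
   i is 1 if i is a value of f and 1 - 1 otherwise. *)
have inner (f : {ffun 'I_n.+1 -> 'I_n.+1}) :
    \sum_(S : {set 'I_n.+1}) (-1) ^+ #|~: S| * \prod_j t S (f j) =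
    (injectiveb f)%:R :> R[i].
  pose c i : R[i] := if i \in codom f then 0 else -1.
  transitivity (\prod_(i < n.+1) (1 + c i)).
    rewrite bigA_distr; apply: eq_bigr => S _.
    have [/forallP fS|] := boolP [forall j, f j \in S].
      rewrite (eq_bigr (fun=> 1)) => [|j _]; last by rewrite /t fS.
      rewrite big1 ?mulr1// -prodr_const big_mkcond /=.
      apply: eq_bigr => i _; rewrite inE; have [//|iS] := boolP (i \in S).
      rewrite /= /c ifN//; apply: contra iS => /codomP[j ->]; exact: fS.
    rewrite negb_forall => /existsP[j jS].
    rewrite (bigD1 j)//= /t (negPf jS) mul0r mulr0.
    by rewrite (bigD1 (f j))//= (negPf jS) /c codom_f mul0r.
  have [fi|fni] := boolP (injectiveb f).
    rewrite big1// => i _; rewrite /c ifT ?addr0//.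
    by apply: inj_card_onto => //; exact/injectiveP.
  have [i ni] : exists i, i \notin codom f.
    apply/existsP; rewrite -negb_forall; apply: contra fni => /forallP fs.
    have /image_injP fI : #|[seq f j | j in 'I_n.+1]| == #|'I_n.+1|.
      by apply/eqP/eq_card => i; rewrite inE; exact: fs.
    by apply/injectiveP => a b; exact: fI.
  by rewrite (bigD1 i)//= /c (negPf ni) subrr mul0r.
transitivity (\sum_(f : {ffun 'I_n.+1 -> 'I_n.+1})
    (injectiveb f)%:R * A (fun j => x (f j))); last first.
  apply: eq_bigr => f _; rewrite -inner big_distrl /=.
  by apply: eq_bigr => S _; rewrite mulrA.
rewrite (bigID (fun f : {ffun 'I_n.+1 -> 'I_n.+1} => injectiveb f)) /=.
rewrite addrC big1 ?add0r => [|f /negPf ->]; last by rewrite mul0r.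
rewrite (reindex (@pval _)) /=; last first.
  pose in_Sn := insubd (1%g : 'S_n.+1).
  by exists in_Sn => /= f Uf; first apply: val_inj; apply: insubdK.
rewrite (eq_big predT (fun=> A x)) => [|s|s _]; rewrite ?(valP s)//; last first.
  rewrite mul1r -[in RHS](hA.2 s x); congr A; apply/funext => j.
  by rewrite pvalE.
by rewrite sumr_const card_Sn mulr_natl.
Qed.
End Multilinear.

(** * Norms and limits of complex numbers *)

Section NrmTheory.
Context {R : realType}.
Local Notation C := (R[i]^o).

Lemma nrm_eq0 {V : normedZmodType R[i]} {x : V} : nrm x = 0 -> x = 0.
Proof. by move=> x0; apply: normr0_eq0; rewrite nrmE x0. Qed.

Lemma nrm0 {V : normedZmodType R[i]} : nrm (0 : V) = 0.
Proof. by rewrite /nrm normr0. Qed.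

Lemma nrmN {V : normedZmodType R[i]} (x : V) : nrm (- x) = nrm x.
Proof. by rewrite /nrm normrN. Qed.

Lemma nrmBC {V : normedZmodType R[i]} (x y : V) : nrm (x - y) = nrm (y - x).
Proof. by rewrite -nrmN opprB. Qed.

Lemma nrmM (a b : C) : nrm (a * b : C) = nrm a * nrm b.
Proof. exact: nrmZ. Qed.

Lemma nrmX (a : C) n : nrm (a ^+ n : C) = nrm a ^+ n.
Proof.
elim: n => [|n IHn]; first by rewrite /nrm normr1.
by rewrite !exprS nrmM IHn.
Qed.

Lemma nrm_real (r : R) : nrm (r%:C : C) = `|r|.
Proof. by rewrite /nrm normc_def /= expr0n addr0 sqrtr_sqr. Qed.

Lemma nrm_nat n : nrm (n%:R : C) = n%:R.
Proof. by rewrite /nrm normr_nat raddfMn /=. Qed.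

Lemma nrmV (a : C) : nrm (a^-1 : C) = (nrm a)^-1.
Proof.
have [->|a0] := eqVneq a 0; first by rewrite invr0 nrm0 invr0.
have na0 : nrm a != 0 by apply: contra_neq a0; exact: nrm_eq0.
by apply: (mulfI na0); rewrite -nrmM !mulfV// /nrm normr1.
Qed.

Lemma Re_le_nrm (z : C) : `|complex.Re z| <= nrm z.
Proof.
rewrite /nrm normc_def /= -sqrtr_sqr ler_sqrt ?addr_ge0 ?sqr_ge0//.
by rewrite lerDl sqr_ge0.
Qed.

Lemma Im_le_nrm (z : C) : `|complex.Im z| <= nrm z.
Proof.
rewrite /nrm normc_def /= -sqrtr_sqr ler_sqrt ?addr_ge0 ?sqr_ge0//.
by rewrite lerDr sqr_ge0.
Qed.

Lemma nrm_le_ReIm (z : C) : nrm z <= `|complex.Re z| + `|complex.Im z|.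
Proof.
rewrite /nrm normc_def /= -(@ler_pXn2r _ 2)// ?nnegrE ?addr_ge0 ?sqrtr_ge0//.
rewrite sqr_sqrtr ?addr_ge0 ?sqr_ge0// sqrrD !real_normK ?num_real//.
by rewrite -addrA lerD2l lerDr mulrn_wge0// mulr_ge0.
Qed.

Lemma nrm_continuousP {V : normedModType R[i]} (P : V -> C) :
  continuous P <-> forall x (e : R), 0 < e -> exists2 d : R, 0 < d &
    forall y, nrm (y - x) < d -> nrm (P y - P x) < e.
Proof.
split=> [Pc x e e0|H x].
  have /cvgrPdist_lt/(_ e%:C) := Pc x.
  rewrite ltcR => /(_ e0)/nbhs_normP[d /= d0 dP].
  have dE : d = (complex.Re d)%:C by rewrite RRe_real// gtr0_real.
  exists (complex.Re d); first by rewrite -ltcR -dE.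
  move=> y yx; rewrite nrmBC -ltcR -nrmE; apply: dP.
  by rewrite /= distrC nrmE dE ltcR.
apply/cvgrPdist_lt => e e0.
have eE : e = (complex.Re e)%:C by rewrite RRe_real// gtr0_real.
have [|d d0 dP] := H x (complex.Re e); first by rewrite -ltcR -eE.
apply/nbhs_normP; exists d%:C => /=; first by rewrite ltcR.
move=> y /=; rewrite distrC nrmE ltcR => /dP.
by rewrite distrC nrmE -ltcR -eE.
Qed.

Lemma real_cvgP (a : nat -> R) (l : R) :
  a @ \oo --> l <-> forall e : R, 0 < e -> exists m : nat,
    forall j, (m <= j)%N -> `|a j - l| < e.
Proof.
split=> [/cvgrPdist_lt al e /al[m _ mP]|H].
  by exists m => j mj; rewrite distrC; exact: mP.
apply/cvgrPdist_lt => e /H[m mP]; exists m => // j mj.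
by rewrite distrC; exact: mP.
Qed.

Lemma real_cauchy_cvg (a : nat -> R) :
  (forall e : R, 0 < e -> exists m : nat,
    forall i j, (m <= i)%N -> (m <= j)%N -> `|a i - a j| < e) ->
  exists l : R, a @ \oo --> l.
Proof.
move=> H; suff : cvg (a @ \oo) by move=> ?; exists (lim (a @ \oo)).
apply/cauchy_cvgP/cauchyP => e /H[m mP].
exists (a m); exists m => // j mj /=.
by rewrite /ball /= mP.
Qed.

Lemma cvg_le_bound {a : nat -> R} {l b : R} (m : nat) :
  a @ \oo --> l -> (forall j, (m <= j)%N -> a j <= b) -> l <= b.
Proof.
move=> al ab; rewrite -(cvg_lim _ al)//; apply: limr_le.
  by apply/cvg_ex; exists l.
by exists m.
Qed.

Lemma cvg_ge_bound {a : nat -> R} {l b : R} (m : nat) :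
  a @ \oo --> l -> (forall j, (m <= j)%N -> b <= a j) -> b <= l.
Proof.
move=> al ab; rewrite -(cvg_lim _ al)//; apply: limr_ge.
  by apply/cvg_ex; exists l.
by exists m.
Qed.

Lemma converges_toP {V : zmodType} {N : V -> R} {u : nat -> V} {v : V} :
  (forall j, 0 <= N (u j - v)) ->
  converges_to N u v <-> forall e : R, 0 < e -> exists m : nat,
    forall j, (m <= j)%N -> N (u j - v) < e.
Proof.
move=> N0; split=> [/real_cvgP H e /H[m mP]|H].
  by exists m => j /mP; rewrite subr0 ger0_norm.
by apply/real_cvgP => e /H[m mP]; exists m => j /mP; rewrite subr0 ger0_norm.
Qed.

(** Coordinatewise, from the completeness of the real line. *)
Lemma complex_complete {z : nat -> C} :
  cauchy_seq_in setT (fun w : C => nrm w) z ->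
  exists w, converges_to (fun w : C => nrm w) z w.
Proof.
move=> [_ zc].
have [|a /real_cvgP az] := @real_cauchy_cvg (fun j => complex.Re (z j)).
  move=> e /zc[m mP]; exists m => i j mi mj.
  by rewrite (le_lt_trans _ (mP i j mi mj))// (le_trans _ (Re_le_nrm _))// raddfB.
have [|b /real_cvgP bz] := @real_cauchy_cvg (fun j => complex.Im (z j)).
  move=> e /zc[m mP]; exists m => i j mi mj.
  by rewrite (le_lt_trans _ (mP i j mi mj))// (le_trans _ (Im_le_nrm _))// raddfB.
exists (a +i* b); apply/converges_toP => [j|e e0]; first exact: nrm_ge0.
have e2 : 0 < e / 2 by rewrite divr_gt0.
have [[m1 h1] [m2 h2]] := (az _ e2, bz _ e2).
exists (maxn m1 m2) => j; rewrite geq_max => /andP[/h1 j1 /h2 j2].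
rewrite (le_lt_trans (nrm_le_ReIm _))// (splitr e) ltrD//.
  by rewrite raddfB.
by rewrite raddfB.
Qed.

End NrmTheory.

(** * Continuous homogeneous polynomials *)

Section Hompoly.
Context {R : realType} {V : normedModType R[i]}.
Local Notation C := (R[i]^o).
Local Notation form n P := (@assoc_form R V n P).
Implicit Types (P Q : V -> C) (n k : nat) (u : nat -> V -> C).

Lemma assoc_formP {n P} : hompoly n P -> is_form_of P (form n P).
Proof. by case=> -[A hA] _; rewrite /assoc_form; case: xgetP => // /(_ A). Qed.

(** Uniqueness is what makes [dhat], defined through a chosen form, additive and
    homogeneous in the polynomial. *)
Lemma form_unique {n P} {A B : ('I_n -> V) -> C} :
  is_form_of P A -> is_form_of P B -> A = B.
Proof.
move=> hA hB; apply/funext => x.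
have n0 : n`!%:R != 0 :> R[i] by rewrite pnatr_eq0 -lt0n fact_gt0.
by apply: (mulfI n0); rewrite (polarization hA) (polarization hB).
Qed.

(** The polarization formula solved for the form: it is a combination, with
    coefficients independent of P, of finitely many values of P, so pointwise
    convergence of polynomials passes to their forms. *)
Lemma assoc_form_polarization {n P} x : hompoly n P ->
  form n P x = \sum_(S : {set 'I_n})
    (n`!%:R^-1 * (-1) ^+ #|~: S|) * P (\sum_(i in S) x i).
Proof.
move=> hP; have n0 : n`!%:R != 0 :> R[i] by rewrite pnatr_eq0 -lt0n fact_gt0.
apply: (mulfI n0); rewrite (polarization (assoc_formP hP)).
by rewrite big_distrr /=; apply: eq_bigr => S _; rewrite !mulrA mulfV// mul1r.
Qed.

Lemma form_linear {n P Q} {A B : ('I_n -> V) -> C} (c : R[i]) :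
  is_form_of P A -> is_form_of Q B ->
  is_form_of (c *: P + Q) (fun x => c *: A x + B x).
Proof.
move=> [[Al As] AP] [[Bl Bs] BQ]; split; last by move=> x; rewrite -AP -BQ.
split=> [i x a u v|s x]; last by rewrite As Bs.
rewrite Al Bl !scalerDr !scalerA (mulrC c a) -!addrA; congr (_ + _).
by rewrite addrCA.
Qed.

Lemma hompolyZ {n P} (t : R[i]) x : hompoly n P -> P (t *: x) = t ^+ n * P x.
Proof.
move=> /assoc_formP[hA AP]; rewrite !AP (multilinearZ hA (fun=> t)).
by rewrite prodr_const card_ord.
Qed.

Lemma hompoly_linear n : linear_subspace (@hompoly R V n).
Proof.
split=> [|c P Q hP hQ].
  split; last by move=> x; exact: cvg_cst.
  exists (fun=> 0); split=> //; split=> // *.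
  by rewrite scaler0 addr0.
split; last first.
  move=> x; apply: (@cvgD _ R[i]^o); last exact: hQ.2.
  by apply: cvgZl_tmp; exact: hP.2.
by exists (fun x => c *: form n P x + form n Q x);
  apply: form_linear; exact: assoc_formP.
Qed.

Lemma sup_norm_ge0 P : 0 <= sup_norm P.
Proof.
rewrite /sup_norm; set S := (X in sup X).
have [[_ ubS]|/sup_out ->//] := pselect (has_sup S).
rewrite (le_trans (nrm_ge0 (P 0)))//; apply: ub_le_sup => //.
by exists 0 => //=; rewrite nrm0.
Qed.

Lemma sup_norm_le P (M : R) :
  (forall x, nrm x <= 1 -> nrm (P x) <= M) -> sup_norm P <= M.
Proof.
move=> PM; apply: ge_sup => [|_ [x /= x1 <-]]; last exact: PM.
by exists (nrm (P 0)), 0 => //=; rewrite nrm0.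
Qed.

(** Continuity at 0 bounds P on a small ball; homogeneity carries the bound to the
    unit ball.  Without this the supremum in [sup_norm] would not be
    meaningful. *)
Lemma hompoly_bounded {n P} : hompoly n P ->
  exists M, forall x, nrm x <= 1 -> nrm (P x) <= M.
Proof.
move=> hP; have /nrm_continuousP/(_ 0 1 ltr01)[d d0 dP] := hP.2.
have d20 : 0 < d / 2 by rewrite divr_gt0.
exists ((1 + nrm (P 0)) / (d / 2) ^+ n) => x x1.
rewrite ler_pdivlMr ?exprn_gt0// mulrC.
have := hompolyZ (d / 2)%:C x hP => /(congr1 (fun z : C => nrm z)).
rewrite nrmM nrmX nrm_real gtr0_norm// => <-.
have := dP ((d / 2)%:C *: x); rewrite subr0 nrmZ nrm_real gtr0_norm//.
move=> h; have {}h := h (le_lt_trans (ler_piMr (ltW d20) x1) _).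
rewrite -[P _](subrK (P 0)) (le_trans (nrmD _ _))// lerD2r ltW// h//.
by rewrite ltr_pdivrMr// ltr_pMr// ltr1n.
Qed.

Lemma nrm_hompoly_le {n P} x : hompoly n P -> nrm (P x) <= sup_norm P * nrm x ^+ n.
Proof.
move=> hP; have [M PM] := hompoly_bounded hP.
have le1 y : nrm y <= 1 -> nrm (P y) <= sup_norm P.
  by move=> y1; apply: ub_le_sup; [exists M => _ [z /= z1 <-]; exact: PM|exists y].
have [->|x0] := eqVneq x 0.
  case: n hP {PM} => [|n] hP; first by rewrite expr0 mulr1 le1// nrm0.
  rewrite nrm0 expr0n mulr0.
  by have := hompolyZ 0 0 hP; rewrite scale0r expr0n mul0r => ->; rewrite nrm0.
have nx0 : 0 < nrm x.
  by rewrite lt_def nrm_ge0 andbT; apply: contra_neq x0; exact: nrm_eq0.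
have -> : nrm (P x) = nrm (P ((nrm x)^-1%:C *: x)) * nrm x ^+ n.
  rewrite (hompolyZ _ _ hP) nrmM nrmX nrm_real gtr0_norm ?invr_gt0//.
  by rewrite mulrAC -exprMn mulVf ?gt_eqF// expr1n mul1r.
rewrite ler_wpM2r ?exprn_ge0 ?nrm_ge0// le1//.
by rewrite nrmZ nrm_real gtr0_norm ?invr_gt0// mulVf ?gt_eqF.
Qed.

Lemma nrm_hompoly_le_sup_norm {n P x} :
  hompoly n P -> nrm x <= 1 -> nrm (P x) <= sup_norm P.
Proof.
move=> hP x1; rewrite (le_trans (nrm_hompoly_le x hP))//.
by rewrite ler_piMr ?sup_norm_ge0// exprn_ile1 ?nrm_ge0.
Qed.

Lemma sup_norm_eq0 {n P} : hompoly n P -> sup_norm P = 0 -> P = 0.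
Proof.
move=> hP P0; apply/funext => x; apply: nrm_eq0; apply/eqP.
rewrite eq_le nrm_ge0 andbT (le_trans (nrm_hompoly_le x hP))//.
by rewrite P0 mul0r.
Qed.

Lemma subspaceB {W : lmodType R[i]} {D : set W} : linear_subspace D ->
  forall v w, D v -> D w -> D (v - w).
Proof. by move=> [_ Dl] v w Dv Dw; rewrite addrC -(scaleN1r w); exact: Dl. Qed.

Lemma sup_converges_pointwise {n u P} : (forall j, hompoly n (u j)) ->
  hompoly n P -> converges_to (@sup_norm R V) u P ->
  forall x, converges_to (fun z : C => nrm z) (u ^~ x) (P x).
Proof.
move=> hu hP /(converges_toP (fun j => sup_norm_ge0 (u j - P))) uP x.
apply/converges_toP => [j|e e0]; first exact: nrm_ge0.
have M0 : 0 < nrm x ^+ n + 1 by rewrite ltr_wpDl ?exprn_ge0 ?nrm_ge0.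
have [|m mP] := uP (e / (nrm x ^+ n + 1)); first by rewrite divr_gt0.
exists m => j /mP uPj.
have hB := subspaceB (hompoly_linear n) _ _ (hu j) hP.
rewrite (le_lt_trans (nrm_hompoly_le x hB))//.
rewrite (@le_lt_trans _ _ (sup_norm (u j - P) * (nrm x ^+ n + 1)))//.
  by rewrite ler_wpM2l ?sup_norm_ge0// lerDl.
by rewrite -ltr_pdivlMr.
Qed.

Lemma converges_unique {z : nat -> C} {a b : C} :
  converges_to (fun w : C => nrm w) z a -> converges_to (fun w : C => nrm w) z b ->
  a = b.
Proof.
move=> /(converges_toP (fun j => nrm_ge0 (z j - a))) za.
move=> /(converges_toP (fun j => nrm_ge0 (z j - b))) zb.
apply/eqP; rewrite -subr_eq0; apply/eqP/nrm_eq0/eqP.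
rewrite eq_le nrm_ge0 andbT; apply/ler_addgt0Pl => e e0; rewrite addr0.
have e2 : 0 < e / 2 by rewrite divr_gt0.
have [[m1 h1] [m2 h2]] := (za _ e2, zb _ e2).
have := h1 _ (leq_maxl m1 m2); have := h2 _ (leq_maxr m1 m2).
set j := maxn m1 m2 => hb ha.
rewrite (_ : a - b = (z j - b) - (z j - a)); last by rewrite opprB [RHS]addrC subrKA.
by rewrite (le_trans (nrmD _ _))// nrmN (splitr e) ltW// ltrD.
Qed.

Lemma eq_converges {z w : nat -> C} {a : C} : z =1 w ->
  converges_to (fun w : C => nrm w) w a -> converges_to (fun w : C => nrm w) z a.
Proof. by move=> /funext ->. Qed.

Lemma converges_linear {z w : nat -> C} {a b : C} (c : R[i]) :
  converges_to (fun w : C => nrm w) z a -> converges_to (fun w : C => nrm w) w b ->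
  converges_to (fun w : C => nrm w) (fun j => c *: z j + w j) (c *: a + b).
Proof.
move=> /(converges_toP (fun j => nrm_ge0 (z j - a))) za.
move=> /(converges_toP (fun j => nrm_ge0 (w j - b))) wb.
apply/converges_toP => [j|e e0]; first exact: nrm_ge0.
have e2 : 0 < e / 2 by rewrite divr_gt0.
have c0 : 0 < nrm (c : C) + 1 by rewrite ltr_wpDl ?nrm_ge0.
have e3 : 0 < e / 2 / (nrm (c : C) + 1) by rewrite divr_gt0.
have [[m1 h1] [m2 h2]] := (za _ e3, wb _ e2).
exists (maxn m1 m2) => j; rewrite geq_max => /andP[/h1 ha /h2 hb].
have -> : c *: z j + w j - (c *: a + b) = c *: (z j - a) + (w j - b).
  by rewrite scalerBr addrACA -opprD.
rewrite (le_lt_trans (nrmD _ _))// (splitr e) ltrD// nrmZ.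
rewrite (@le_lt_trans _ _ ((nrm (c : C) + 1) * nrm (z j - a)))//.
  by rewrite ler_wpM2r ?nrm_ge0// lerDl.
by rewrite mulrC -ltr_pdivlMr.
Qed.

Lemma converges_sum (I : finType) (z : I -> nat -> C) (a : I -> C) (c : I -> R[i]) :
  (forall i, converges_to (fun w : C => nrm w) (z i) (a i)) ->
  converges_to (fun w : C => nrm w) (fun j => \sum_i c i * z i j) (\sum_i c i * a i).
Proof.
move=> za; suff H (r : seq I) : converges_to (fun w : C => nrm w)
    (fun j => \sum_(i <- r) c i * z i j) (\sum_(i <- r) c i * a i) by exact: H.
elim: r => [|i r IHr].
  rewrite /converges_to big_nil.
  under eq_fun do rewrite big_nil subr0 nrm0.
  exact: cvg_cst.
rewrite big_cons; apply: eq_converges => [j|]; first by rewrite big_cons.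
exact: converges_linear.
Qed.

Lemma assoc_form_converges {n u P} : (forall j, hompoly n (u j)) -> hompoly n P ->
  (forall x, converges_to (fun z : C => nrm z) (u ^~ x) (P x)) ->
  forall x, converges_to (fun z : C => nrm z)
    (fun j => form n (u j) x) (form n P x).
Proof.
move=> hu hP uP x; rewrite assoc_form_polarization//.
apply: (eq_converges (fun j => assoc_form_polarization x (hu j))).
by apply: converges_sum => S; exact: uP.
Qed.

(** A sequence that is Cauchy for the sup norm converges at every point, uniformly
    on balls by homogeneity, so the limit is continuous; it is a homogeneous
    polynomial because by polarization the forms converge pointwise too, and
    multilinearity and symmetry survive pointwise limits. *)
Lemma hompoly_complete {n u} :
  cauchy_seq_in (hompoly n) (@sup_norm R V) u ->
  exists2 P, hompoly n P & converges_to (@sup_norm R V) u P.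
Proof.
move=> [hu uc].
have Bh i j : hompoly n (u i - u j).
  exact: (subspaceB (hompoly_linear n) _ _ (hu i) (hu j)).
have pc x : cauchy_seq_in setT (fun w : C => nrm w) (u ^~ x).
  split=> // e e0.
  have M0 : 0 < nrm x ^+ n + 1 by rewrite ltr_wpDl ?exprn_ge0 ?nrm_ge0.
  have [|m mP] := uc (e / (nrm x ^+ n + 1)); first by rewrite divr_gt0.
  exists m => i j mi mj; rewrite (le_lt_trans (nrm_hompoly_le x (Bh i j)))//.
  rewrite (@le_lt_trans _ _ (sup_norm (u i - u j) * (nrm x ^+ n + 1)))//.
    by rewrite ler_wpM2l ?sup_norm_ge0// lerDl.
  by rewrite -ltr_pdivlMr// mP.
have [P uP] := choice (fun x => complex_complete (pc x)).
have close e : 0 < e -> exists m, forall j, (m <= j)%N ->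
    forall x, nrm (u j x - P x) <= e * nrm x ^+ n.
  move=> e0; have [m mP] := uc e e0; exists m => j mj x.
  apply/ler_addgt0Pl => d d0.
  have /(converges_toP (fun j => nrm_ge0 (u j x - P x)))/(_ d d0)[m' m'P] := uP x.
  have := m'P _ (leq_maxr m m'); set i := maxn m m' => di.
  have -> : u j x - P x = (u i x - P x) + (u j - u i) x.
    by rewrite [RHS]addrC /= subrKA.
  rewrite (le_trans (nrmD _ _))// lerD//; first exact: ltW.
  rewrite (le_trans (nrm_hompoly_le x (Bh j i)))//.
  by rewrite ler_wpM2r ?exprn_ge0 ?nrm_ge0// ltW// mP// leq_maxl.
have formE j := assoc_formP (hu j).
have [A uA] : exists A : ('I_n -> V) -> C, forall x,
    converges_to (fun w : C => nrm w) (fun j => form n (u j) x) (A x).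
  exists (fun x => \sum_(S : {set 'I_n}) (n`!%:R^-1 * (-1) ^+ #|~: S|) *
     P (\sum_(i in S) x i)) => x.
  apply: (eq_converges (fun j => assoc_form_polarization x (hu j))).
  exact: converges_sum.
have hP : hompoly n P.
  split.
    exists A; split.
      split=> [i x c a b|s x].
        apply: (converges_unique (uA _)).
        apply: eq_converges => [j|]; first exact: (formE j).1.1.
        exact: converges_linear.
      apply: (converges_unique (uA _)).
      by apply: eq_converges => [j|]; [exact: (formE j).1.2|exact: uA].
    move=> x; apply: (converges_unique (uP x)).
    by apply: eq_converges => [j|]; [exact: (formE j).2|exact: uA].
  apply/nrm_continuousP => x e e0.
  have r0 : 0 < (nrm x + 1) ^+ n by rewrite exprn_gt0// ltr_wpDl ?nrm_ge0.
  have e3 : 0 < e / 3%:R by rewrite divr_gt0.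
  have [|m /(_ m (leqnn m)) mP] := close (e / 3%:R / (nrm x + 1) ^+ n).
    by rewrite divr_gt0.
  have [d d0 dP] := (nrm_continuousP (u m)).1 (hu m).2 x _ e3.
  (* Within distance 1 of x everything happens in the ball of radius |x| + 1, on
     which u m is within e / 3 of P. *)
  exists (Order.min d 1); first by rewrite lt_min d0 ltr01.
  move=> y; rewrite lt_min => /andP[/dP yd y1].
  have near z : nrm z <= nrm x + 1 -> nrm (u m z - P z) <= e / 3%:R.
    move=> zx; rewrite (le_trans (mP z))// mulrAC ler_pdivrMr//.
    by rewrite ler_wpM2l ?(ltW e3)// lerXn2r ?nnegrE ?nrm_ge0 ?addr_ge0 ?nrm_ge0.
  have nx := near x (ltW (ltr_pwDr ltr01 (lexx _))).
  have ny : nrm (u m y - P y) <= e / 3%:R.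
    by rewrite near// -[y](subrK x) addrC (le_trans (nrmD _ _))// lerD2l// ltW.
  have -> : P y - P x = (u m y - u m x) + ((u m x - P x) - (u m y - P y)).
    by rewrite opprB [RHS]addrC -addrA subrKA [RHS]addrC subrKA.
  rewrite (le_lt_trans (nrmD _ _))//.
  rewrite (@lt_le_trans _ _ (e / 3%:R + (e / 3%:R + e / 3%:R)))//.
    by rewrite ltr_leD// (le_trans (nrmD _ _))// nrmN lerD.
  lra.
exists P => //; apply/converges_toP => [j|e e0]; first exact: sup_norm_ge0.
have [|m mP] := close (e / 2); first by rewrite divr_gt0.
exists m => j mj; apply: (@le_lt_trans _ _ (e / 2)); last first.
  by rewrite gtr_pMr// invf_lt1// ltr1n.
apply: sup_norm_le => x x1; rewrite (le_trans (mP j mj x))//.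
by rewrite ler_piMr ?divr_ge0 ?(ltW e0)// exprn_ile1 ?nrm_ge0.
Qed.

Lemma dhat_linear {n k} (c : R[i]) P Q a : hompoly n P -> hompoly n Q ->
  dhat n k (c *: P + Q) a = c *: dhat n k P a + dhat n k Q a.
Proof.
move=> hP hQ; apply/funext => y; rewrite /dhat.
rewrite (form_unique (assoc_formP ((hompoly_linear n).2 c _ _ hP hQ))
  (form_linear c (assoc_formP hP) (assoc_formP hQ))).
by rewrite [RHS]/= scalerDr !scalerA mulrC.
Qed.

Lemma dhatB {n k P Q} a : hompoly n P -> hompoly n Q ->
  dhat n k (P - Q) a = dhat n k P a - dhat n k Q a.
Proof.
move=> hP hQ; have -> : P - Q = (-1) *: Q + P by rewrite scaleN1r addrC.
by rewrite (dhat_linear (-1) _ _ a hQ hP) scaleN1r addrC.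
Qed.

Lemma dhat_converges {n k u P} a : (forall j, hompoly n (u j)) -> hompoly n P ->
  (forall x, converges_to (fun z : C => nrm z) (u ^~ x) (P x)) ->
  forall y, converges_to (fun z : C => nrm z)
    (fun j => dhat n k (u j) a y) (dhat n k P a y).
Proof.
move=> hu hP uP y.
have /(_ (fun i : 'I_n => if (i < n - k)%N then a else y)) :=
  assoc_form_converges hu hP uP.
move=> h.
have := converges_linear (n`!%:R / (n - k)`!%:R) h (_ : converges_to _ (fun=> 0) 0).
rewrite addr0 => {}h; apply: eq_converges (h _) => [j|]; first by rewrite addr0.
rewrite /converges_to; under eq_fun do rewrite subr0 nrm0.
exact: cvg_cst.
Qed.

Lemma dhat0 {n P} a y : hompoly n P -> dhat n 0 P a y = P a.
Proof.
move=> hP; rewrite /dhat subn0 divff ?pnatr_eq0 -?lt0n ?fact_gt0// scale1r.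
rewrite (assoc_formP hP).2; congr (@assoc_form _ _ _ _ _); apply/funext => i.
by rewrite ltn_ord.
Qed.

End Hompoly.

(** * The gauge of the bipolar *)

Section Gauge.
Context {R : realType} {E : normedModType R[i]}.
Local Notation C := (R[i]^o).
Context {n : nat} {D : set (E -> C)} {N : (E -> C) -> R} {D' : set (dual E -> C)}.
Hypothesis linD : linear_subspace D.
Hypothesis N_ge0 : forall P, D P -> 0 <= N P /\ (N P = 0 -> P = 0).
Hypothesis NZ : forall (c : R[i]) P, D P -> N (c *: P) = nrm (c : C) * N P.
Hypothesis borel_bij : set_bij (functionals D N) D' (borel n).
Local Notation p := (bipolar_gauge n D N D').

Let D0 : D 0. Proof. exact: linD.1. Qed.

Let DZ c P : D P -> D (c *: P).
Proof. by move=> DP; rewrite -[_ *: _]addr0; exact: linD.2. Qed.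

Let DD P Q : D P -> D Q -> D (P + Q).
Proof. by move=> DP DQ; rewrite -[P]scale1r; exact: linD.2. Qed.

Definition linear_on (L : (E -> C) -> C) : Prop :=
  forall (c : R[i]) P Q, D P -> D Q -> L (c *: P + Q) = c *: L P + L Q.

Lemma linear_on0 L : linear_on L -> L 0 = 0.
Proof.
move=> hL; have := hL 1 0 0 D0 D0; rewrite !scale1r addr0 => /eqP.
by rewrite -subr_eq subrr => /eqP.
Qed.

Lemma linear_onZ L c P : linear_on L -> D P -> L (c *: P) = c *: L P.
Proof.
by move=> hL DP; have := hL c P 0 DP D0; rewrite (linear_on0 _ hL) !addr0.
Qed.

Lemma linear_onD L P Q : linear_on L -> D P -> D Q -> L (P + Q) = L P + L Q.
Proof. by move=> hL DP DQ; have := hL 1 P Q DP DQ; rewrite !scale1r. Qed.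

Lemma linear_onB L P Q : linear_on L -> D P -> D Q -> L (P - Q) = L P - L Q.
Proof.
by move=> hL DP DQ; rewrite addrC -scaleN1r hL// scaleN1r addrC.
Qed.

(** The functionals of dual norm at most 1; under the Borel transform they are the
    elements of the polar of the unit ball. *)
Definition contractive (T : (E -> C) -> C) : Prop :=
  functionals D N T /\ forall P, D P -> nrm (T P) <= N P.

Lemma pairing_borel T P : functionals D N T -> pairing n D N P (borel n T) = T P.
Proof.
move=> hT; rewrite /pairing /borel_inv; case: xgetP => [S _ [hS ST]|/(_ T)].
  by have [_ inj _] := borel_bij; rewrite (inj S T _ _ ST)//; exact: mem_set.
by case.
Qed.

(** A vector of N-norm 0 vanishes, so a bound on the unit ball rescales to all
    vectors. *)
Lemma contractiveP T : functionals D N T ->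
  (forall P, unit_ball D N P -> nrm (T P) <= 1) -> contractive T.
Proof.
move=> hT T1; split=> // P DP; have [P0 P0E] := N_ge0 _ DP.
have linT : linear_on T by case: hT.
have [NP0|NP0] := eqVneq (N P) 0.
  by rewrite NP0 P0E// (linear_on0 _ linT) nrm0.
have NPgt0 : 0 < N P by rewrite lt_def NP0.
have := T1 ((N P)^-1%:C *: P); rewrite linear_onZ// nrmZ nrm_real.
rewrite gtr0_norm ?invr_gt0// mulrC ler_pdivrMr// mul1r; apply.
split; first exact: DZ.
by rewrite NZ// nrm_real gtr0_norm ?invr_gt0// mulVf.
Qed.

Lemma bipolarP P :
  bipolar n D N D' P <-> D P /\ forall T, contractive T -> nrm (T P) <= 1.
Proof.
have [bT _ bS] := borel_bij.
split=> -[DP h]; split=> //.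
  move=> T [hT TN]; rewrite -(pairing_borel T P hT); apply: h.
  split=> [|Q [DQ Q1]]; first exact: bT.
  by rewrite pairing_borel// (le_trans (TN _ DQ)).
move=> Q [D'Q Q1]; have [T hT TQ] := bS _ D'Q.
rewrite -TQ pairing_borel//; apply: h; apply: contractiveP => // S S1.
by rewrite -(pairing_borel T S hT) TQ; exact: Q1.
Qed.

Lemma gauge_setP P d : D P -> 0 < d ->
  (exists2 P0, bipolar n D N D' P0 & P = d%:C *: P0) <->
  forall T, contractive T -> nrm (T P) <= d.
Proof.
move=> DP d0; split=> [[P0 /bipolarP[DP0 h] ->] T cT|h].
  have linT : linear_on T by case: cT => -[].
  rewrite linear_onZ// nrmZ nrm_real gtr0_norm// -[leRHS]mulr1.
  by rewrite ler_wpM2l ?(ltW d0)// h.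
exists (d^-1%:C *: P).
  apply/bipolarP; split=> [|T cT]; first exact: DZ.
  have linT : linear_on T by case: cT => -[].
  rewrite linear_onZ// nrmZ nrm_real gtr0_norm ?invr_gt0// mulrC.
  by rewrite ler_pdivrMr// mul1r h.
by rewrite scalerA -rmorphM /= mulfV ?gt_eqF// scale1r.
Qed.

Lemma gauge_ge0 P : 0 <= p P.
Proof.
rewrite /bipolar_gauge; set S := (X in inf X).
have [->|/set0P S0] := eqVneq S set0; first by rewrite inf0.
by apply: lb_le_inf => // d [/ltW].
Qed.

(** Together with the next lemma: the gauge at P is the supremum of the moduli of
    T P over contractive T.  Homogeneity, subadditivity and the transfer principle
    below are read off this description. *)
Lemma gauge_le P (r : R) : D P -> 0 <= r ->
  (forall T, contractive T -> nrm (T P) <= r) -> p P <= r.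
Proof.
move=> DP r0 Tr; apply/ler_addgt0Pl => e e0.
(* The gauge ranges over d > 0 only, hence the extra e when r = 0. *)
have re0 : 0 < e + r by rewrite ltr_wpDr.
apply: ge_inf; first by exists 0 => d [/ltW].
split=> //; apply/gauge_setP => // T /Tr; move/le_trans; apply.
by rewrite lerDr ltW.
Qed.

Lemma contractive_le_gauge T P : D P -> contractive T -> nrm (T P) <= p P.
Proof.
move=> DP cT; apply: lb_le_inf; last by move=> d [d0 /(gauge_setP _ _ DP d0)]; exact.
have NP0 := (N_ge0 _ DP).1.
have N1 : 0 < N P + 1 by rewrite ltr_wpDl.
exists (N P + 1); split=> //; apply/gauge_setP => // S [_ SN].
by rewrite (le_trans (SN _ DP))// lerDl.
Qed.

(** The transfer principle: for M > 0 the functional L / M, extended by 0 outside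
    D, is contractive.  Continuity is automatic from the bound, even though N
    satisfies only a quasi-triangle inequality. *)
Lemma dominated_le_gauge L (M : R) : linear_on L -> 0 <= M ->
  (forall P, D P -> nrm (L P) <= M * N P) ->
  forall P, D P -> nrm (L P) <= M * p P.
Proof.
move=> linL M0 LM P DP.
have [M00|Mn0] := eqVneq M 0.
  by rewrite (le_trans (LM P DP))// M00 !mul0r.
have Mgt0 : 0 < M by rewrite lt_def Mn0.
pose T Q := if `[< D Q >] then M^-1%:C *: L Q else 0.
have TE Q : D Q -> T Q = M^-1%:C *: L Q by rewrite /T => DQ; rewrite ifT//; apply/asboolP.
have linT : linear_on T.
  move=> c Q S DQ DS; rewrite !TE//; last exact: linD.2.
  by rewrite linL// scalerDr !scalerA mulrC.
have TN Q : D Q -> nrm (T Q) <= N Q.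
  move=> DQ; rewrite TE// nrmZ nrm_real gtr0_norm ?invr_gt0// mulrC.
  by rewrite ler_pdivrMr// mulrC LM.
have cT : contractive T.
  split=> //; split=> //.
    move=> Q DQ e e0; exists e => // S DS SQ.
    by rewrite -linear_onB// (le_lt_trans (TN _ _))//; exact: subspaceB.
  by move=> Q nDQ; rewrite /T ifF//; apply/asboolP.
have := contractive_le_gauge T P DP cT; rewrite TE// nrmZ nrm_real.
by rewrite gtr0_norm ?invr_gt0// mulrC ler_pdivrMr// mulrC.
Qed.

Lemma gaugeZ_le c P : D P -> p (c *: P) <= nrm (c : C) * p P.
Proof.
move=> DP; apply: gauge_le; first exact: DZ.
  by rewrite mulr_ge0 ?nrm_ge0 ?gauge_ge0.
move=> T cT; rewrite linear_onZ//; last by case: cT => -[].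
by rewrite nrmZ ler_wpM2l ?nrm_ge0// contractive_le_gauge.
Qed.

(** Transfer principle for the evaluations at points of the unit ball. *)
Lemma sup_norm_le_gauge K : D `<=` @hompoly R E n -> 0 <= K ->
  (forall P, D P -> sup_norm P <= K * N P) ->
  forall P, D P -> sup_norm P <= K * p P.
Proof.
move=> Dh K0 DK P DP; apply: sup_norm_le => x x1.
apply: (dominated_le_gauge (fun Q => Q x)) => // Q DQ.
by rewrite (le_trans _ (DK Q DQ))// (nrm_hompoly_le_sup_norm (Dh Q DQ)).
Qed.

Lemma gauge_normed K : D `<=` @hompoly R E n -> 0 <= K ->
  (forall P, D P -> sup_norm P <= K * N P) -> normed D p.
Proof.
move=> Dh K0 DK; split=> //.
- move=> P DP; split; first exact: gauge_ge0.
  move=> P0; apply: (sup_norm_eq0 (Dh P DP)); apply/eqP.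
  rewrite eq_le sup_norm_ge0 andbT.
  by rewrite (le_trans (sup_norm_le_gauge K Dh K0 DK P DP))// P0 mulr0.
- move=> c P DP; apply/eqP; rewrite eq_le gaugeZ_le//=.
  have [->|c0] := eqVneq c 0; first by rewrite nrm0 mul0r gauge_ge0.
  have nc : 0 < nrm (c : C).
    by rewrite lt_def nrm_ge0 andbT; apply: contra_neq c0; exact: nrm_eq0.
  have := gaugeZ_le c^-1 (c *: P) (DZ _ _ DP).
  by rewrite scalerA mulVf// scale1r nrmV ler_pdivlMl.
- move=> P Q DP DQ; apply: gauge_le; first exact: DD.
    by rewrite addr_ge0 ?gauge_ge0.
  move=> T cT; rewrite linear_onD//; last by case: cT => -[].
  by rewrite (le_trans (nrmD _ _))// lerD// contractive_le_gauge.
Qed.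

End Gauge.

(** * The completion inside the homogeneous polynomials *)

Section Completion.
Context {R : realType} {E : normedModType R[i]}.
Local Notation C := (R[i]^o).
Context {n : nat} {D : set (E -> C)} {N : (E -> C) -> R} {D' : set (dual E -> C)}.
Context {K : R}.
Local Notation p := (bipolar_gauge n D N D').
Local Notation q := (completion_norm n D N D').
Local Notation X := (completion_in_hompoly n D N D').
Local Notation represents := (completion_point n D N D').
Hypothesis Dhom : D `<=` @hompoly R E n.
Hypothesis p_normed : normed D p.
Hypothesis K_ge0 : 0 <= K.
Hypothesis sup_norm_le_p : forall P, D P -> sup_norm P <= K * p P.

Let linD : linear_subspace D. Proof. by case: p_normed. Qed.

Let p_ge0 P : D P -> 0 <= p P.
Proof. by case: p_normed => _ h _ _ /h[]. Qed.

Let pZ c P : D P -> p (c *: P) = nrm (c : C) * p P.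
Proof. by case: p_normed => _ _ h _; exact: h. Qed.

Let pD P Q : D P -> D Q -> p (P + Q) <= p P + p Q.
Proof. by case: p_normed => _ _ _; apply. Qed.

Let DB P Q : D P -> D Q -> D (P - Q).
Proof. exact: subspaceB. Qed.

Let D0 : D 0. Proof. exact: linD.1. Qed.

Let DZ c P : D P -> D (c *: P).
Proof. by move=> DP; rewrite -[_ *: _]addr0; exact: linD.2. Qed.

Let DD P Q : D P -> D Q -> D (P + Q).
Proof. by move=> DP DQ; rewrite -[P]scale1r; exact: linD.2. Qed.

Let p0 : p 0 = 0.
Proof. by have := pZ 0 0 D0; rewrite scale0r nrm0 mul0r. Qed.

Let pBC P Q : D P -> D Q -> p (P - Q) = p (Q - P).
Proof.
move=> DP DQ; rewrite -opprB -scaleN1r pZ; last exact: DB.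
by rewrite nrmN /nrm normr1 mul1r.
Qed.

Let p_tri P Q S : D P -> D Q -> D S -> p (P - S) <= p (P - Q) + p (Q - S).
Proof. by move=> DP DQ DS; rewrite -(subrKA Q P) pD//; exact: DB. Qed.

Let p_dist P Q : D P -> D Q -> `|p P - p Q| <= p (P - Q).
Proof.
move=> DP DQ.
have h1 : p P <= p (P - Q) + p Q by rewrite -{1}(subrK Q P) pD//; exact: DB.
have h2 : p Q <= p (P - Q) + p P.
  by rewrite pBC// -{1}(subrK P Q) pD//; exact: DB.
by rewrite ler_norml; apply/andP; split; move: h1 h2; lra.
Qed.

Lemma cauchy_gauge_cvg {u} : cauchy_seq_in D p u ->
  exists l : R, (fun j => p (u j)) @ \oo --> l.
Proof.
move=> [Du uc]; apply: real_cauchy_cvg => e /uc[m mP].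
by exists m => i j mi mj; rewrite (le_lt_trans (p_dist _ _ (Du i) (Du j)))// mP.
Qed.

Lemma cauchy_represents {u} : cauchy_seq_in D p u -> exists P, represents u P.
Proof.
move=> hu; have [Du uc] := hu.
have [|P hP uP] := @hompoly_complete R E n u; last by exists P; split.
split=> [j|e e0]; first exact: Dhom.
have K1 : 0 < K + 1 by rewrite ltr_wpDl.
have [|m mP] := uc (e / (K + 1)); first by rewrite divr_gt0.
exists m => i j mi mj; rewrite (le_lt_trans (sup_norm_le_p _ (DB _ _ (Du i) (Du j))))//.
rewrite (@le_lt_trans _ _ ((K + 1) * p (u i - u j)))//.
  by rewrite ler_wpM2r ?lerDl// p_ge0//; exact: DB.
by rewrite mulrC -ltr_pdivlMr// mP.
Qed.

Lemma represents_const P : D P -> represents (fun=> P) P.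
Proof.
move=> DP; split; first split=> // e e0.
- by exists 0%N => *; rewrite subrr p0.
- exact: Dhom.
- apply/converges_toP => [j|e e0]; first exact: sup_norm_ge0.
  exists 0%N => j _; rewrite subrr (le_lt_trans _ e0)//.
  by apply: sup_norm_le => x _; rewrite nrm0.
Qed.

Lemma represents_linear c u v P Q : represents u P -> represents v Q ->
  represents (fun j => c *: u j + v j) (c *: P + Q).
Proof.
move=> [[Du uc] hP uP] [[Dv vc] hQ vQ].
have c0 : 0 < nrm (c : C) + 1 by rewrite ltr_wpDl ?nrm_ge0.
have cE (a b a' b' : E -> C) :
    c *: a + b - (c *: a' + b') = c *: (a - a') + (b - b').
  by rewrite scalerBr addrACA -opprD.
split; last 1 first.
- move: uP vQ => /(converges_toP (fun j => sup_norm_ge0 (u j - P))) uP.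
  move=> /(converges_toP (fun j => sup_norm_ge0 (v j - Q))) vQ.
  apply/converges_toP => [j|e e0]; first exact: sup_norm_ge0.
  have e2 : 0 < e / 2 by rewrite divr_gt0.
  have e3 : 0 < e / 2 / (nrm (c : C) + 1) by rewrite divr_gt0.
  have [[m1 h1] [m2 h2]] := (uP _ e3, vQ _ e2).
  exists (maxn m1 m2) => j; rewrite geq_max => /andP[/h1 ha /h2 hb].
  have huP : hompoly n (u j - P) by apply: subspaceB; [exact: hompoly_linear|exact: Dhom|].
  have hvQ : hompoly n (v j - Q) by apply: subspaceB; [exact: hompoly_linear|exact: Dhom|].
  rewrite cE (@le_lt_trans _ _
    ((nrm (c : C) + 1) * sup_norm (u j - P) + sup_norm (v j - Q)))//.
    apply: sup_norm_le => x x1.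
    rewrite (le_trans (nrmD _ _))// lerD ?(nrm_hompoly_le_sup_norm hvQ)// nrmZ.
    by rewrite ler_pM ?nrm_ge0 ?(nrm_hompoly_le_sup_norm huP)// lerDl.
  by rewrite (splitr e) ltrD// mulrC -ltr_pdivlMr.
- split=> [j|e e0]; first exact: linD.2.
  have e2 : 0 < e / 2 by rewrite divr_gt0.
  have e3 : 0 < e / 2 / (nrm (c : C) + 1) by rewrite divr_gt0.
  have [[m1 h1] [m2 h2]] := (uc _ e3, vc _ e2).
  exists (maxn m1 m2) => i j; rewrite !geq_max => /andP[i1 i2] /andP[j1 j2].
  have ha := h1 i j i1 j1; have hb := h2 i j i2 j2.
  have [Duu Dvv] : D (u i - u j) /\ D (v i - v j) by split; exact: DB.
  rewrite cE (le_lt_trans (pD _ _ (DZ c _ Duu) Dvv))//.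
  rewrite (splitr e) ltrD// pZ//.
  rewrite (@le_lt_trans _ _ ((nrm (c : C) + 1) * p (u i - u j)))//.
    by rewrite ler_wpM2r ?p_ge0// lerDl.
  by rewrite mulrC -ltr_pdivlMr.
- exact: (hompoly_linear n).2.
Qed.

Lemma completion_norm_ge0 P : 0 <= q P.
Proof.
rewrite /completion_norm; set S := (X in inf X).
have [->|/set0P S0] := eqVneq S set0; first by rewrite inf0.
apply: lb_le_inf => // l [u [[Du _] _ _] ul].
by apply: (cvg_ge_bound 0 ul) => j _; exact: p_ge0.
Qed.

Lemma completion_norm_le {u P} {l : R} : represents u P ->
  (fun j => p (u j)) @ \oo --> l -> q P <= l.
Proof.
move=> uP ul; apply: ge_inf; last by exists u.
exists 0 => k [v [[Dv _] _ _] vl].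
by apply: (cvg_ge_bound 0 vl) => j _; exact: p_ge0.
Qed.

Lemma completion_norm_lt {P} {r : R} : X P -> q P < r ->
  exists u (l : R), [/\ represents u P, (fun j => p (u j)) @ \oo --> l & l < r].
Proof.
move=> [u uP] qr; have e0 : 0 < r - q P by rewrite subr_gt0.
have [|l [v vP vl] lr] := @inf_adherent R _ _ e0 (_ : has_inf
  [set l : R | exists2 u, represents u P & (fun j => p (u j)) @ \oo --> l]).
  split; last first.
    exists 0 => k [v [[Dv _] _ _] vl].
    by apply: (cvg_ge_bound 0 vl) => j _; exact: p_ge0.
  by have [l ul] := cauchy_gauge_cvg (let: And3 h _ _ := uP in h); exists l, u.
exists v, l; split=> //; move: lr; rewrite -/(q P).
by rewrite addrC subrK.
Qed.

(** The form in which bounds are proved on the completion: for M >= 0 it suffices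
    to prove them with the limit of the gauge along every representing sequence
    in place of the norm. *)
Lemma completion_norm_ge {P} (b M : R) : X P -> 0 <= M ->
  (forall u (l : R), represents u P -> (fun j => p (u j)) @ \oo --> l -> b <= M * l) ->
  b <= M * q P.
Proof.
move=> XP M0 H; apply/ler_addgt0Pl => e e0.
have M1 : 0 < M + 1 by rewrite ltr_wpDl.
have e1 : 0 < e / (M + 1) by rewrite divr_gt0.
have [|u [l [uP ul lq]]] := @completion_norm_lt P (q P + e / (M + 1)) XP.
  by rewrite ltrDl.
rewrite (le_trans (H u l uP ul))// (le_trans (ler_wpM2l M0 (ltW lq)))//.
rewrite mulrDr addrC lerD2r mulrA ler_pdivrMr// mulrC ler_wpM2l ?(ltW e0)//.
by rewrite lerDl.
Qed.

(** A bound for the value at x by the gauge survives the passage to the limit. *)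
Lemma represents_nrm_le {u P} {l M : R} x : 0 <= M ->
  (forall Q, D Q -> nrm (Q x) <= M * p Q) ->
  represents u P -> (fun j => p (u j)) @ \oo --> l -> nrm (P x) <= M * l.
Proof.
move=> M0 HM [[Du _] hP uP] /real_cvgP ul; apply/ler_addgt0Pl => e e0.
have := sup_converges_pointwise (fun j => Dhom _ (Du j)) hP uP x.
move=> /(converges_toP (fun j => nrm_ge0 (u j x - P x))) ux.
have M1 : 0 < M + 1 by rewrite ltr_wpDl.
have e2 : 0 < e / 2 by rewrite divr_gt0.
have e3 : 0 < e / 2 / (M + 1) by rewrite divr_gt0.
have [[m1 h1] [m2 h2]] := (ux _ e2, ul _ e3).
have := h1 _ (leq_maxl m1 m2); have := h2 _ (leq_maxr m1 m2).
set j := maxn m1 m2 => hb ha.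
have -> : P x = u j x - (u j x - P x) by rewrite opprB addrC subrK.
rewrite (le_trans (nrmD _ _))// nrmN.
have pj : p (u j) <= l + e / 2 / (M + 1).
  by rewrite addrC -lerBlDr ltW// (le_lt_trans (ler_norm _)).
have Mpj : M * p (u j) <= M * l + e / 2.
  rewrite (le_trans (ler_wpM2l M0 pj))// mulrDr lerD2l mulrCA ler_piMr ?(ltW e2)//.
  by rewrite ler_pdivrMr// mul1r lerDl.
have := HM _ (Du j); move: ha Mpj; lra.
Qed.

Lemma sup_norm_le_completion_norm {P} : X P -> sup_norm P <= K * q P.
Proof.
move=> XP; apply: completion_norm_ge => // u l uP ul.
apply: sup_norm_le => x x1; apply: (represents_nrm_le x _ _ uP ul) => // Q DQ.
rewrite (le_trans _ (sup_norm_le_p _ DQ))//.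
exact: (nrm_hompoly_le_sup_norm (Dhom _ DQ)).
Qed.

Lemma completion_linear : linear_subspace X.
Proof.
split; first by exists (fun=> 0); exact: represents_const.
move=> c P Q [u uP] [v vQ]; exists (fun j => c *: u j + v j).
exact: represents_linear.
Qed.

Lemma completion_normD P Q : X P -> X Q -> q (P + Q) <= q P + q Q.
Proof.
move=> XP XQ; apply/ler_addgt0Pl => e e0.
have e2 : 0 < e / 2 by rewrite divr_gt0.
have [|u [l [uP ul lq]]] := @completion_norm_lt P (q P + e / 2) XP; first by rewrite ltrDl.
have [|v [k [vQ vk kq]]] := @completion_norm_lt Q (q Q + e / 2) XQ; first by rewrite ltrDl.
have uv := represents_linear 1 u v P Q uP vQ; rewrite scale1r in uv.
have [m uvm] := cauchy_gauge_cvg (let: And3 h _ _ := uv in h).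
have mlk : m <= l + k.
  have lk : (fun j => p (u j) + p (v j)) @ \oo --> l + k by exact: cvgD.
  rewrite -(cvg_lim _ uvm)// -(cvg_lim _ lk)//; apply: ler_lim.
  - by apply/cvg_ex; exists m.
  - by apply/cvg_ex; exists (l + k).
  - near=> j => /=; rewrite scale1r; apply: pD.
      by case: uP => -[].
    by case: vQ => -[].
rewrite (le_trans (completion_norm_le uv uvm))//.
by move: mlk lq kq; lra.
Unshelve. all: end_near. Qed.

Lemma completion_normZ_le c P : X P -> q (c *: P) <= nrm (c : C) * q P.
Proof.
move=> XP; apply: completion_norm_ge => //; first exact: nrm_ge0.
move=> u l uP ul; have [Du _] : cauchy_seq_in D p u by case: uP.
have := represents_linear c u (fun=> 0) P 0 uP (represents_const 0 D0).
rewrite addr0 => cuP; apply: (completion_norm_le cuP).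
rewrite (_ : (fun j => _) = (fun j => nrm (c : C) * p (u j))).
  exact: cvgMr.
by apply/funext => j; rewrite addr0 pZ.
Qed.

(** Definiteness comes from the bound of the sup norm: a polynomial of norm 0
    vanishes on the unit ball. *)
Lemma completion_normed : normed X q.
Proof.
split.
- exact: completion_linear.
- move=> P XP; split; first exact: completion_norm_ge0.
  move=> P0; have [u [_ hP _]] := XP.
  apply: (sup_norm_eq0 hP); apply/eqP; rewrite eq_le sup_norm_ge0 andbT.
  by rewrite (le_trans (sup_norm_le_completion_norm XP))// P0 mulr0.
- move=> c P XP; apply/eqP; rewrite eq_le completion_normZ_le//=.
  have [->|c0] := eqVneq c 0; first by rewrite nrm0 mul0r completion_norm_ge0.
  have nc : 0 < nrm (c : C).
    by rewrite lt_def nrm_ge0 andbT; apply: contra_neq c0; exact: nrm_eq0.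
  have XcP : X (c *: P).
    rewrite -[_ *: _]addr0; apply: completion_linear.2 => //.
    exact: completion_linear.1.
  have := completion_normZ_le c^-1 (c *: P) XcP.
  by rewrite scalerA mulVf// scale1r nrmV ler_pdivlMl.
- exact: completion_normD.
Qed.

Lemma represents_dist {u P v} {e : R} m : represents u P -> D v ->
  (forall j, (m <= j)%N -> p (u j - v) <= e) -> q (P - v) <= e.
Proof.
move=> uP Dv uv.
have := represents_linear (-1) (fun=> v) u v P (represents_const v Dv) uP.
rewrite scaleN1r addrC => uvP.
have [l ul] := cauchy_gauge_cvg (let: And3 h _ _ := uvP in h).
rewrite (le_trans (completion_norm_le uvP ul))//.
by apply: (cvg_le_bound m ul) => j /uv; rewrite addrC.
Qed.

(** Approximation from D with control of the gauge of the approximant itself: its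
    gauge may exceed its completion norm when the completion does not embed into
    the polynomials, so density alone would not give the first bound. *)
Lemma completion_approx {P} {r e : R} : X P -> q P < r -> 0 < e ->
  exists w, [/\ D w, p w < r & q (P - w) < e].
Proof.
move=> XP qr e0; have [u [l [uP ul lr]]] := completion_norm_lt XP qr.
have [Du uc] : cauchy_seq_in D p u by case: uP.
have /real_cvgP/(_ (r - l))[|m1 h1] := ul; first by rewrite subr_gt0.
have [|m2 h2] := uc (e / 2); first by rewrite divr_gt0.
set j := maxn m1 m2; exists (u j); split=> //.
  have := le_lt_trans (ler_norm _) (h1 j (leq_maxl _ _)).
  by rewrite ltrD2r.
apply: (@le_lt_trans _ _ (e / 2)); last by rewrite gtr_pMr// invf_lt1// ltr1n.
apply: (represents_dist m2 uP (Du j)) => i mi.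
by apply/ltW/h2 => //; exact: leq_maxr.
Qed.

Lemma sub_completion : D `<=` X.
Proof. by move=> P DP; exists (fun=> P); exact: represents_const. Qed.

Lemma geometric_cauchy {x : nat -> E -> C} : (forall j, D (x j)) ->
  (forall j, p (x j.+1 - x j) < 2^-1 ^+ j) ->
  forall i j, (i <= j)%N -> p (x j - x i) <= 2 * 2^-1 ^+ i.
Proof.
move=> Dx xs i j ij; rewrite -(subnK ij) addnC.
suff H m : p (x (i + m)%N - x i) <= 2 * 2^-1 ^+ i - 2 * 2^-1 ^+ (i + m).
  by rewrite (le_trans (H _))// lerBlDr lerDl mulr_ge0// exprn_ge0// invr_ge0.
elim: m => [|m IHm]; first by rewrite addn0 !subrr p0.
rewrite addnS (le_trans (p_tri _ _ _ (Dx _) (Dx (i + m)%N) (Dx _)))//.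
have := xs (i + m)%N; move: IHm; rewrite exprS; lra.
Qed.

(** A Cauchy sequence P for the carried-over (quotient) norm need not be
    approximated by an arbitrary sequence of D that is Cauchy for the gauge.  One
    builds x i in D with P j eventually within 2^-i of x i, each x (i + 1) being
    x i plus an approximant of P j - x i of gauge less than 2^-i.  Then x is Cauchy
    for the gauge, and the polynomial it represents is the limit of P. *)
Lemma completion_banach : banach X q.
Proof.
split; first exact: completion_normed.
have [_ _ q_Z _] := completion_normed.
have XB := subspaceB completion_linear.
have qD P Q S : X P -> X Q -> X S -> q (P - S) <= q (P - Q) + q (Q - S).
  by move=> XP XQ XS; rewrite -(subrKA Q P) completion_normD//; exact: XB.
move=> P [XP Pc].
have step x (r e : R) : D x -> 0 < e ->
    (exists m, forall j, (m <= j)%N -> q (P j - x) < r) ->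
    exists x', [/\ D x', p (x' - x) < r &
      exists m, forall j, (m <= j)%N -> q (P j - x') < e].
  move=> Dx e0 [m1 h1].
  have e2 : 0 < e / 2 by rewrite divr_gt0.
  have [m2 h2] := Pc _ e2.
  pose j0 := maxn m1 m2.
  have Xx := sub_completion _ Dx.
  have [w [Dw pw qw]] := completion_approx (XB _ _ (XP j0) Xx) (h1 j0 (leq_maxl _ _)) e2.
  exists (x + w); split; [exact: DD|by rewrite addrC addKr|exists m2 => j mj].
  have Xxw := sub_completion _ (DD _ _ Dx Dw).
  rewrite (le_lt_trans (qD _ _ _ (XP j) (XP j0) Xxw))// (splitr e) ltrD//.
    by rewrite h2// leq_maxr.
  by rewrite opprD addrA.
pose good i x := D x /\ exists m, forall j, (m <= j)%N -> q (P j - x) < 2^-1 ^+ i.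
have h2 i : 0 < 2^-1 ^+ i :> R by rewrite exprn_gt0// invr_gt0.
have [x0 x0P] : exists x, good 0%N x.
  have [m h] := Pc 1 ltr01.
  have [|x [Dx _ xP]] := step 0 (q (P m) + 1) (2^-1 ^+ 0) D0 (h2 0%N); last by exists x.
  exists m => j mj; rewrite subr0 addrC -ltrBlDr (le_lt_trans _ (h j m mj (leqnn m)))//.
  rewrite lerBlDr -{1}(subrK (P m) (P j)) completion_normD//; exact: XB.
(* The index is carried along so that dependent choice sees a fixed relation. *)
have next (s : {s : nat * (E -> C) | good s.1 s.2}) :
    {s' : {s : nat * (E -> C) | good s.1 s.2} |
      (sval s').1 = (sval s).1.+1 /\
      p ((sval s').2 - (sval s).2) < 2^-1 ^+ (sval s).1}.
  apply: cid; case: s => -[i x] /= [Dx xP].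
  have [x' [Dx' px' x'P]] := step x _ _ Dx (h2 i.+1) xP.
  by exists (exist _ (i.+1, x') (conj Dx' x'P)).
have [f [f0 fS]] := dependent_choice next (exist _ (0%N, x0) x0P).
have fi i : (sval (f i)).1 = i by elim: i => [|i IHi]; [rewrite f0|rewrite (fS i).1 IHi].
pose x i := (sval (f i)).2.
have gx i : good i (x i) by have := svalP (f i); rewrite fi.
have Dx i : D (x i) by case: (gx i).
have px i : p (x i.+1 - x i) < 2^-1 ^+ i by have [_] := fS i; rewrite fi.
have geo := geometric_cauchy Dx px.
have small (e : R) : 0 < e -> exists i, 2 * 2^-1 ^+ i < e.
  move=> e0; have : (GRing.exp (2^-1 : R)) @ \oo --> (0 : R).
    by apply: cvg_expr; rewrite ger0_norm ?invr_ge0// invf_lt1// ltr1n.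
  move=> /real_cvgP/(_ (e / 2))[|m /(_ m (leqnn m))]; first by rewrite divr_gt0.
  rewrite subr0 gtr0_norm// => h; exists m.
  by rewrite mulrC -ltr_pdivlMr.
have xc : cauchy_seq_in D p x.
  split=> // e e0; have [|m hm] := small (e / 2); first by rewrite divr_gt0.
  exists m => i j mi mj.
  rewrite (le_lt_trans (p_tri _ (x m) _ _ _ _))// (splitr e) ltrD//.
    by rewrite (le_lt_trans (geo _ _ mi)).
  by rewrite pBC// (le_lt_trans (geo _ _ mj)).
have [Q xQ] := cauchy_represents xc.
have XQ : X Q by exists x.
exists Q => //; apply/converges_toP => [j|e e0]; first exact: completion_norm_ge0.
have [|i hi] := small (e / 2); first by rewrite divr_gt0.
have [_ [m mP]] := gx i.
exists m => j /mP Pj; have Xx := sub_completion _ (Dx i).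
rewrite (le_lt_trans (qD _ _ _ (XP j) Xx XQ))// (splitr e) ltr_leD//.
  by rewrite (lt_trans Pj)// (le_lt_trans _ hi)// ler_peMl ?ler1n// ltW.
rewrite -opprB -scaleN1r q_Z; last exact: XB.
rewrite nrmN /nrm normr1 mul1r.
by rewrite (represents_dist i xQ)// => k ik; rewrite (le_trans (geo _ _ ik))// ltW.
Qed.

End Completion.

(** * The holomorphy type *)

Section Types.
Context {R : realType} {E : normedModType R[i]}.
Local Notation C := (R[i]^o).

Lemma constants_hompoly : @constants R E `<=` @hompoly R E 0.
Proof.
move=> _ [c ->]; split; last by move=> x; exact: cvg_cst.
by exists (fun=> c); split=> //; split=> // -[].
Qed.

Lemma constants_banach : banach (@constants R E) (@constants_norm R E).
Proof.
split.
  split.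
  - split; first by exists 0.
    by move=> c _ _ [a ->] [b ->]; exists (c *: a + b).
  - move=> _ [c ->]; split; first exact: nrm_ge0.
    by move=> /nrm_eq0 c0; apply/funext => x; exact: c0.
  - by move=> c P _; exact: nrmZ.
  - by move=> P Q _ _; exact: nrmD.
move=> u [uconst uc].
have [|w uw] := @complex_complete R (fun j => u j 0); first by split.
by exists (cst w) => //; exists w.
Qed.

Section Family.
Context {D : nat -> set (E -> C)} {N : nat -> (E -> C) -> R}
  {D' : nat -> set (dual E -> C)} {N' : nat -> (dual E -> C) -> R}
  {c : nat -> nat -> R}.
Hypothesis hstd : standing_assumptions D N D' N'.
Hypothesis hstable : stable_for_derivatives D N c.
Local Notation p n := (bipolar_gauge n (D n) (N n) (D' n)).
Local Notation q n := (completion_norm n (D n) (N n) (D' n)).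
Local Notation X n := (completion_in_hompoly n (D n) (N n) (D' n)).

Let linD n : (0 < n)%N -> linear_subspace (D n).
Proof. by move=> /(std_quasi_normed hstd)[]. Qed.

Let N_ge0 n : (0 < n)%N -> forall P, D n P -> 0 <= N n P /\ (N n P = 0 -> P = 0).
Proof. by move=> /(std_quasi_normed hstd)[]. Qed.

Let NZ n : (0 < n)%N ->
  forall (a : R[i]) P, D n P -> N n (a *: P) = nrm (a : C) * N n P.
Proof. by move=> /(std_quasi_normed hstd)[]. Qed.

Let borel_bij n : (0 < n)%N -> set_bij (functionals (D n) (N n)) (D' n) (borel n).
Proof. by move=> /(std_borel hstd)[]. Qed.

Let Dhom n : (0 < n)%N -> D n `<=` @hompoly R E n.
Proof. exact: std_hompoly hstd n. Qed.

(** In positive degrees the gauge satisfies all that the study of the completion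
    requires. *)
Lemma bipolar_gauge_normed n : (0 < n)%N -> exists K : R,
  [/\ 0 <= K, normed (D n) (p n) & forall P, D n P -> sup_norm P <= K * p n P].
Proof.
move=> n0; have [K K0 DK] := std_sup_norm hstd n0; exists K; split; first exact: ltW.
- exact: (gauge_normed (linD _ n0) (N_ge0 _ n0) (NZ _ n0) (borel_bij _ n0) K
    (Dhom _ n0) (ltW K0) DK).
- exact: (sup_norm_le_gauge (linD _ n0) (N_ge0 _ n0) (NZ _ n0) (borel_bij _ n0) K
    (Dhom _ n0) (ltW K0) DK).
Qed.

(** Transfer principle for the functionals sending u to T (dhat n k u a), with T
    contractive in degree k: stability bounds them by the quasi-norm of u. *)
Lemma gauge_dhat_le n k a P : (0 < k)%N -> (k <= n)%N -> D n P ->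
  p k (dhat n k P a) <= c n k * nrm a ^+ (n - k) * p n P.
Proof.
move=> k0 kn DP; have n0 := leq_trans k0 kn.
have [hD /(_ _ _ kn)[c0 hN]] := hstable.
have M0 : 0 <= c n k * nrm a ^+ (n - k) by rewrite mulr_ge0// exprn_ge0// nrm_ge0.
apply: (gauge_le (linD _ k0) (N_ge0 _ k0) (NZ _ k0) (borel_bij _ k0)).
- exact: hD.
- by rewrite mulr_ge0// gauge_ge0.
move=> T [[linT _ _] TN].
apply: (dominated_le_gauge (linD _ n0) (N_ge0 _ n0) (NZ _ n0) (borel_bij _ n0)
  (fun u => T (dhat n k u a))) => //.
  move=> b u v Du Dv; rewrite dhat_linear; [|exact: Dhom..].
  by rewrite linT//; exact: hD.
move=> u Du; rewrite (le_trans (TN _ (hD _ _ _ _ Du kn)))//.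
by rewrite mulrAC hN.
Qed.

(** The case k = 0, where the space of degree 0 is the scalar field and the
    functional is the evaluation at a. *)
Lemma nrm_le_gauge n a P : (0 < n)%N -> D n P ->
  nrm (P a) <= c n 0 * nrm a ^+ n * p n P.
Proof.
move=> n0; have [hD /(_ _ _ (leq0n n))[c0 hN]] := hstable.
move: P; apply: (dominated_le_gauge (linD _ n0) (N_ge0 _ n0) (NZ _ n0)
  (borel_bij _ n0) (fun u => u a)) => //.
  by rewrite mulr_ge0// exprn_ge0// nrm_ge0.
move=> P DP; have := hN P a DP; rewrite (std_0 hstd).2; last exact: hD.
by rewrite /constants_norm dhat0 ?subn0 1?mulrAC//; exact: Dhom.
Qed.

(** If u represents P then the sequence of the dhat n k (u j) a is Cauchy for the
    gauge of degree k, so it represents some Q; as it converges to dhat n k P a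
    pointwise, the two limits agree. *)
Lemma completion_dhat n k a P : (0 < k)%N -> (k <= n)%N -> X n P ->
  X k (dhat n k P a) /\
  q k (dhat n k P a) <= c n k * nrm a ^+ (n - k) * q n P.
Proof.
move=> k0 kn XP; have n0 := leq_trans k0 kn.
have [K [K0 pn pK]] := bipolar_gauge_normed _ n0.
have [K' [K'0 pk pK']] := bipolar_gauge_normed _ k0.
have [hD /(_ _ _ kn)[c0 _]] := hstable.
set M := c n k * nrm a ^+ (n - k).
have M0 : 0 <= M by rewrite mulr_ge0// exprn_ge0// nrm_ge0.
have lift u : completion_point n (D n) (N n) (D' n) u P ->
    completion_point k (D k) (N k) (D' k) (fun j => dhat n k (u j) a) (dhat n k P a).
  move=> [[Du uc] hP uP].
  have hu j : hompoly n (u j) := Dhom _ n0 _ (Du j).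
  have vc : cauchy_seq_in (D k) (p k) (fun j => dhat n k (u j) a).
    split=> [j|e e0]; first exact: hD.
    have M1 : 0 < M + 1 by rewrite ltr_wpDl.
    have [|m mP] := uc (e / (M + 1)); first by rewrite divr_gt0.
    exists m => i j mi mj; have Dij := subspaceB (linD _ n0) _ _ (Du i) (Du j).
    rewrite -(dhatB a (hu i) (hu j)).
    rewrite (le_lt_trans (gauge_dhat_le _ _ a _ k0 kn Dij))// -/M.
    rewrite (@le_lt_trans _ _ ((M + 1) * p n (u i - u j)))//.
      by rewrite ler_wpM2r ?gauge_ge0// lerDl.
    by rewrite mulrC -ltr_pdivlMr// mP.
  have [Q vQ] := cauchy_represents (Dhom _ k0) pk K'0 pK' vc.
  suff -> : dhat n k P a = Q by [].
  case: vQ => _ hQ vQ; apply/funext => y.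
  apply: (converges_unique (dhat_converges a hu hP (sup_converges_pointwise hu hP uP) y)).
  by apply: (sup_converges_pointwise _ hQ vQ) => j; apply: (Dhom _ k0); exact: hD.
split; first by have [u /lift] := XP; exists (fun j => dhat n k (u j) a).
apply: (completion_norm_ge pn) => // u l uP ul.
have vP := lift u uP.
have [m vm] := cauchy_gauge_cvg pk (let: And3 h _ _ := vP in h).
rewrite (le_trans (completion_norm_le pk vP vm))//.
have Ml : (fun j => M * p n (u j)) @ \oo --> M * l by exact: cvgMr.
rewrite -(cvg_lim _ vm)// -(cvg_lim _ Ml)//; apply: ler_lim.
- by apply/cvg_ex; exists m.
- by apply/cvg_ex; exists (M * l).
- by near=> j; apply: gauge_dhat_le => //; case: uP => -[].
Unshelve. all: end_near. Qed.

Lemma completion_nrm_le n a P : (0 < n)%N -> X n P ->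
  nrm (P a) <= c n 0 * nrm a ^+ n * q n P.
Proof.
move=> n0 XP; have [K [K0 pn pK]] := bipolar_gauge_normed _ n0.
have [_ /(_ _ _ (leq0n n))[c0 _]] := hstable.
have M0 : 0 <= c n 0 * nrm a ^+ n by rewrite mulr_ge0// exprn_ge0// nrm_ge0.
apply: (completion_norm_ge pn) => // u l uP ul.
apply: (represents_nrm_le (Dhom _ n0) a M0 _ uP ul) => Q DQ.
exact: nrm_le_gauge.
Qed.

End Family.

Lemma bin_le_exp2 n k : ('C(n, k) <= 2 ^ n)%N.
Proof.
have [kn|nk] := leqP k n; last by rewrite bin_small.
rewrite -[2%N]/((1 + 1)%N) expnDn (bigD1 (Ordinal (kn : (k < n.+1)%N)))//=.
by rewrite !exp1n !muln1 leq_addr.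
Qed.

End Types.

Theorem corollary2p9 (R : realType) (E : completeNormedModType R[i])
    (D : nat -> set (E -> R[i]^o)) (N : nat -> (E -> R[i]^o) -> R)
    (D' : nat -> set (dual E -> R[i]^o)) (N' : nat -> (dual E -> R[i]^o) -> R)
    (c : nat -> nat -> R)
    (hstd : standing_assumptions D N D' N')
    (hstable : stable_for_derivatives D N c)
    (hc : forall n k : nat, (k <= n)%N -> c n k <= n`!%:R / (n - k)`!%:R) :
  holomorphy_type (tilde D N D') (tilde_norm D N D').
Proof.
have f0 m : 0 < m`!%:R :> R by rewrite ltr0n fact_gt0.
have banachX n : (0 < n)%N -> banach (completion_in_hompoly n (D n) (N n) (D' n))
    (completion_norm n (D n) (N n) (D' n)).
  move=> n0; have [K [K0 pn pK]] := bipolar_gauge_normed hstd _ n0.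
  exact: (completion_banach (std_hompoly hstd n0) pn K0 pK).
split.
- by case=> [|n]; [exact: constants_banach|exact: banachX].
- by case=> [|n] P; [exact: constants_hompoly|case=> u []].
- by split.
(* Dividing n! / (n - k)! by k! leaves a binomial coefficient, at most 2 ^ n. *)
exists 2%:R; first by rewrite ler1n.
have bound n k a (Q M : R) : (k <= n)%N -> 0 <= M ->
    Q <= c n k * nrm (a : E) ^+ (n - k) * M ->
    k`!%:R^-1 * Q <= 2 ^+ n * M * nrm a ^+ (n - k).
  move=> kn M0 QM; have a0 : 0 <= nrm a ^+ (n - k) by rewrite exprn_ge0// nrm_ge0.
  rewrite ler_pdivrMl// (le_trans QM)// [leRHS]mulrA mulrAC -!mulrA [M * _]mulrC.
  rewrite !mulrA ler_wpM2r// ler_wpM2r// (le_trans (hc n k kn))//.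
  rewrite ler_pdivrMr// -natrX -!natrM ler_nat -(bin_fact kn).
  by rewrite mulnC [leqRHS]mulnAC leq_mul2l bin_le_exp2 orbT.
case=> [|n] [|k] a P // kn XP /=.
- have [b Pb] := XP; rewrite /tilde /= in XP.
  have dP : dhat 0 0 P a = P.
    apply/funext => y; rewrite dhat0; first by rewrite Pb.
    exact: constants_hompoly.
  rewrite dP; split=> //; rewrite fact0 invr1 scale1r !expr0 mul1r mulr1//.
- have hP : hompoly n.+1 P by case: XP => u [].
  have dP : dhat n.+1 0 P a = cst (P a) by apply/funext => y; rewrite dhat0.
  rewrite dP; split; first by exists (P a).
  have [[_ q0 _ _] _] := banachX n.+1 (ltn0Sn n).
  have := bound n.+1 0%N a (nrm (P a)) _ (leq0n _) (q0 _ XP).1.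
  rewrite fact0 !invr1 scale1r mul1r subn0; apply.
  exact: (completion_nrm_le hstd hstable).
- have [Xd qd] := completion_dhat hstd hstable _ _ a _ (ltn0Sn k) kn XP.
  split=> //; have [[_ _ qZ _] _] := banachX k.+1 (ltn0Sn k).
  rewrite qZ// nrmV nrm_nat; apply: bound => //.
  by have [[_ q0 _ _] _] := banachX n.+1 (ltn0Sn n); have [] := q0 _ XP.
Qed.
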